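(* For every knotoid $k$, $2h_+(k) \geq \deg_u^-(\langle\!\langle k\rangle\!\rangle_\circ)$ and $2h_-(k) \geq \deg_u^+(\langle\!\langle k\rangle\!\rangle_\circ)$, where $\langle\!\langle k\rangle\!\rangle_\circ$ is the normalized Turaev polynomial of $k$.
   Context: A knotoid diagram $K$ is an immersion of a closed interval into the oriented sphere $S^2$ whose only singularities are transverse double crossings (the endpoints are not crossing points), together with over/under information at each crossing; it is oriented from its tail $v_0$ to its head $v_1$. A knotoid is a class of knotoid diagrams up to isotopy of $S^2$ and the Reidemeister moves I, II, III performed away from the endpoints (no strand may be moved over or under an endpoint). A shortcut for $K$ is an embedded path $a$ in $S^2$ from $v_0$ to $v_1$ that intersects $K$ transversely and does not pass through crossings of $K$. The common endpoints $v_0,v_1$ are not counted as intersections. Orienting $a$ from $v_0$ to $v_1$, an intersection of an oriented strand with $a$ is positive ($+$) if the strand crosses $a$ from the right of $a$ to the left of $a$, and negative ($-$) otherwise. A pair $(K,a)$ is a shortcut diagram, representing the knotoid represented by $K$; $h_\pm(K,a)$ is the number of positive/negative intersections of $K$ with $a$. The signed heights $h_+(k)$ and $h_-(k)$ of a knotoid $k$ are the minima of $h_+(K,a)$ and of $h_-(K,a)$, respectively, each taken separately over all shortcut diagrams representing $k$. A state $s$ of $K$ is a function from the set of crossings to $\{-,+\}$. The $s$-smoothing of $K$ smooths each crossing by the usual Kauffman bracket rule: a $+$ crossing is replaced by its $A$-smoothing (joining the two regions swept out when the overstrand is rotated counterclockwise), a $-$ crossing by its $A^{-1}$-smoothing.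 The result is one embedded interval from $v_0$ to $v_1$ together with $\ell(s)$ embedded circles. Let $n(s)$ be the sum of $s(c)=\pm1$ over all crossings $c$. For a shortcut diagram $(K,a)$ let $a(K)=h_+(K,a)-h_-(K,a)$, and let $a(s)$ be the algebraic number (positive minus negative) of intersections with $a$ of the interval component of the $s$-smoothing, oriented from $v_0$ to $v_1$. Set $$\langle\!\langle K,a\rangle\!\rangle=\sum_s A^{n(s)}u^{a(s)}(-A^2-A^{-2})^{\ell(s)}\in\mathbb Z[A^{\pm1},u^{\pm1}],\qquad \langle\!\langle K,a\rangle\!\rangle_\circ=(-A)^{-3\,\mathrm{wr}(K)}u^{-a(K)}\langle\!\langle K,a\rangle\!\rangle,$$ where $\mathrm{wr}(K)$ is the writhe (sum of the crossing signs). The polynomial $\langle\!\langle K,a\rangle\!\rangle_\circ$ is known to depend only on the knotoid $k$ represented by $(K,a)$, and is denoted $\langle\!\langle k\rangle\!\rangle_\circ$. For a nonzero Laurent polynomial $p$ in $A,u$, $\deg_u^+(p)$ is the maximum of $0$ and the largest exponent of $u$ in $p$; $\deg_u^-(p)$ is the maximum of $0$ and the negative of the smallest exponent of $u$ in $p$; $\deg_u^\pm(0)=0$. *)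

(* Defs.v *)
From HB Require Import structures.
From Stdlib Require Import Relation_Operators.
From mathcomp Require Import all_boot all_order all_algebra.
From mathcomp Require Import finmap.
From mathcomp Require Import monalg.
From mathcomp Require Import boolp classical_sets.

Set Implicit Arguments.
Unset Strict Implicit.
Unset Printing Implicit Defensive.

Import Order.TTheory GRing.Theory Num.Theory.
Local Open Scope ring_scope.

(* Z[A^±1, u^±1]: the coefficient at the key (i, j) is that of A^i u^j.  The
   library gives {malg int[K]} a ring structure only for monoids K without
   nontrivial units, hence the construction of the product below. *)
Definition laurent : Type := {malg int[(int * int)%type]}.

HB.instance Definition _ := GRing.Zmodule.on laurent.

Section LaurentRing.

Local Open Scope fset_scope.
Local Notation K := (int * int)%type.
Implicit Types (g : {malg int[K]}) (k : K).

Definition lone : {malg int[K]} := << 1 *g (0, 0) : K >>.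

Definition lmul g1 g2 : {malg int[K]} :=
  \sum_(k1 <- msupp g1) \sum_(k2 <- msupp g2)
    << g1@_k1 * g2@_k2 *g (k1 + k2)%R >>.

Lemma lmulw (d1 d2 : {fset K}) g1 g2 :
  msupp g1 `<=` d1 -> msupp g2 `<=` d2 ->
  lmul g1 g2 =
    \sum_(k1 <- d1) \sum_(k2 <- d2) << g1@_k1 * g2@_k2 *g (k1 + k2)%R >>.
Proof.
move=> le_d1 le_d2; rewrite /lmul (big_fset_incl _ le_d1) /=.
  apply/eq_bigr=> k1 _; apply/big_fset_incl => // k _ /mcoeff_outdom ->.
  by rewrite mulr0 monalgU0.
move=> k _ /mcoeff_outdom g1k.
by rewrite big1 => // k' _; rewrite g1k mul0r monalgU0.
Qed.

Lemma lmulC : commutative lmul.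
Proof.
move=> g1 g2; rewrite /lmul exchange_big /=.
by apply/eq_bigr=> k2 _; apply/eq_bigr=> k1 _; rewrite mulrC [(k1 + k2)%R]addrC.
Qed.

Lemma lmul0g g : lmul 0 g = 0.
Proof. by rewrite /lmul msupp0 big_seq_fset0. Qed.

Lemma lmulUg c k g :
  lmul << c *g k >> g = \sum_(k' <- msupp g) << c * g@_k' *g (k + k')%R >>.
Proof.
rewrite (lmulw msuppU_le (fsubset_refl _)) big_seq_fset1.
by apply/eq_bigr => k' _; rewrite mcoeffUU.
Qed.

Lemma lmulUU c1 c2 k1 k2 :
  lmul << c1 *g k1 >> << c2 *g k2 >> = << c1 * c2 *g (k1 + k2)%R >>.
Proof. by rewrite (lmulw msuppU_le msuppU_le) !big_seq_fset1 !mcoeffUU. Qed.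

Lemma lmulEl g1 g2 :
  lmul g1 g2 = \sum_(k1 <- msupp g1) lmul << g1@_k1 *g k1 >> g2.
Proof. by apply/eq_bigr=> k _; rewrite lmulUg. Qed.

Lemma lmulEr g1 g2 :
  lmul g1 g2 = \sum_(k2 <- msupp g2) lmul g1 << g2@_k2 *g k2 >>.
Proof. by rewrite lmulC lmulEl; apply/eq_bigr=> k _; rewrite lmulC. Qed.

Lemma lmul1g : left_id lone lmul.
Proof.
move=> g; rewrite lmulUg [RHS]monalgE.
by apply/eq_bigr=> k _; rewrite mul1r [((0, 0) + k)%R]add0r.
Qed.

Lemma lmulDl : left_distributive lmul +%R.
Proof.
move=> g1 g2 g.
rewrite [in RHS](lmulw (fsubsetUl _ (msupp g2)) (fsubset_refl _)).
rewrite [in RHS](lmulw (fsubsetUr (msupp g1) _) (fsubset_refl _)).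
rewrite (lmulw (msuppD_le _ _) (fsubset_refl _)).
rewrite -big_split /=; apply/eq_bigr=> k1 _.
rewrite -big_split /=; apply/eq_bigr=> k2 _.
by rewrite mcoeffD mulrDl monalgUD.
Qed.

Lemma lmulDr g : {morph lmul g : x y / (x + y)%R}.
Proof. by move=> x y; rewrite lmulC lmulDl ![lmul _ g]lmulC. Qed.

Lemma lmulg0 g : lmul g 0 = 0.
Proof. by rewrite lmulC lmul0g. Qed.

Lemma lmulA : associative lmul.
Proof.
move=> g1 g2 g3.
rewrite [RHS](big_morph (lmul^~ _) (fun _ _ => lmulDl _ _ _) (lmul0g _)).
rewrite lmulEl; apply/eq_bigr=> k1 _.
rewrite [LHS](big_morph (lmul _) (lmulDr _) (lmulg0 _)).
rewrite [RHS](big_morph (lmul^~ _) (fun _ _ => lmulDl _ _ _) (lmul0g _)).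
apply/eq_bigr=> k2 _.
rewrite [LHS](big_morph (lmul _) (lmulDr _) (lmulg0 _)).
rewrite [RHS]lmulEr; apply/eq_bigr=> k3 _.
by rewrite !lmulUU mulrA addrA.
Qed.

Lemma lone_neq0 : lone != 0.
Proof. by apply/eqP=> /malgP /(_ (0, 0)) /eqP; rewrite mcoeffUU mcoeff0. Qed.

End LaurentRing.

HB.instance Definition _ := GRing.Zmodule_isComNzRing.Build laurent
  lmulA lmulC lmul1g lmulDl lone_neq0.

Definition lunit : pred laurent := fun p => `[< exists q, q * p = 1 >].
Definition linv (p : laurent) : laurent := xget p [set q | q * p = 1]%classic.

Lemma lmulVr : {in lunit, left_inverse 1 linv *%R}.
Proof. by move=> p /asboolP [q qp]; rewrite /linv; case: xgetP => [y _ //|/(_ q)]. Qed.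

Lemma lunitPl (p q : laurent) : q * p = 1 -> lunit p.
Proof. by move=> qp; apply/asboolP; exists q. Qed.

Lemma linv_out : {in [predC lunit], linv =1 id}.
Proof.
move=> p /negP np; rewrite /linv; case: xgetP => // y _ yp.
by case: np; apply: lunitPl yp.
Qed.

HB.instance Definition _ := GRing.ComNzRing_hasMulInverse.Build laurent
  lmulVr lunitPl linv_out.

Definition varA : laurent := << 1 *g (1, 0) >>.
Definition varu : laurent := << 1 *g (0, 1) >>.

Lemma varA_unit : varA \is a GRing.unit.
Proof. by apply: (@lunitPl _ << 1 *g (-1, 0) >>); apply: lmulUU. Qed.

Lemma varu_unit : varu \is a GRing.unit.
Proof. by apply: (@lunitPl _ << 1 *g (0, -1) >>); apply: lmulUU. Qed.

Definition deg_u_plus (p : laurent) : int :=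
  \big[Num.max/0]_(k <- msupp (p : {malg int[(int * int)%type]})) k.2.
Definition deg_u_minus (p : laurent) : int :=
  \big[Num.max/0]_(k <- msupp (p : {malg int[(int * int)%type]})) - k.2.

Local Open Scope nat_scope.

(* A knotoid diagram up to isotopy of the oriented sphere is a plane
   combinatorial map (crossings, edges, counterclockwise rotations) with
   over/under information, and this map is recorded by the signed Gauss code of
   the immersed interval: the sequence of its passes through crossings, read
   from tail to head.  A crossing is a label together with its sign
   (true = positive); a pass is a crossing together with a boolean telling
   whether it is traversed along the overstrand (true) or understrand (false). *)
Definition crossing := (nat * bool)%type.
Definition pass := (crossing * bool)%type.

(* What a strand K meets on its way when a shortcut a is also drawn:
   inl p is a pass through a crossing of K, and inr j is the (j+1)-st
   intersection with a, counted along a from its tail. *)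
Definition item := (pass + nat)%type.

(* A strand from v0 to v1 meeting n items has half-edges (i, x), i <= n, where
   x = true for the half-edge entering a vertex and x = false for the one
   leaving it.  Places 1, ..., n are the items in order, and place 0 stands for
   both endpoints: (0, false) is the half-edge at v0 and (0, true) the one
   at v1.  Thus the edges of the strand join (i, false) to (i+1, true) for
   i < n, and (n, false) to (0, true). *)
Definition strand_edge n (d : 'I_n.+1 * bool) : 'I_n.+1 * bool :=
  if d.2 then (ord_pred d.1, false) else (ordS d.1, true).

(* Counterclockwise, the half-edges at a crossing of upper and lower strands are
     lower in, upper out, lower out, upper in   if the crossing is positive,
     lower in, upper in, lower out, upper out   if it is negative;
   so the half-edge following a half-edge of direction x of the upper or lower
   strand belongs to the other strand, and has the following direction. *)
Definition turn (upper positive x : bool) : bool := x (+) (upper (+) positive).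

Section Strand.

Variable w : seq item.

Definition dart := ('I_(size w).+1 * bool)%type.

Definition item_at (i : 'I_(size w).+1) : option item :=
  nth None (None :: map Some w) i.

Definition place (x : item) : 'I_(size w).+1 := inord (index x w).+1.

(* The rotation of the map formed by the strand alone: endpoints are leaves,
   and the points inr j are bivalent vertices. *)
Definition strand_rot (d : dart) : dart :=
  match item_at d.1 with
  | None => d
  | Some (inl (c, o)) => (place (inl (c, ~~ o)), turn o c.2 d.2)
  | Some (inr _) => (d.1, ~~ d.2)
  end.

End Strand.

(* Euler's formula #vertices - #edges + #faces = 2 for a connected map, where
   vertices, edges and faces are the orbits of vertex, edge and vertex \o edge. *)
Definition spherical (D : finType) (vertex edge : D -> D) : bool :=
  fcard vertex predT + fcard (vertex \o edge) predT == fcard edge predT + 2.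

Definition well_formed (K : seq pass) : bool :=
  uniq K && all (fun p : pass => (p.1, ~~ p.2) \in K) K.

Record diagram := Diagram {
  code : seq pass;
  code_wf : well_formed code;
  code_spherical :
    spherical (@strand_rot (map inl code)) (@strand_edge (size (map inl code))) }.

Definition crossings (K : seq pass) : seq crossing := [seq p.1 | p <- K & p.2].

Definition sign (b : bool) : int := if b then 1%R else (-1)%R.

Definition writhe (K : seq pass) : int := (\sum_(c <- crossings K) sign c.2)%R.

Definition directed (e : bool) (s : seq pass) : seq pass := if e then s else rev s.

(* In RIII, the three strands are the top one, passing over x and y, the middle
   one, passing under x and over z, and the bottom one, passing under y and z;
   t, m, b say whether they meet these crossings in that order.  The equations
   between signs express that the path x -> y -> z -> x turns at its three
   corners in the same direction, that is, that it bounds a triangular face.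
   In RII, the opposite signs likewise express that the bigon is a face.  When
   a move creates crossings, the two edges involved bound a common face because
   moves are only considered between spherical codes. *)
Inductive diagram_move : seq pass -> seq pass -> Prop :=
| Relabel (f : crossing -> crossing) K of
    injective f & (forall c, (f c).2 = c.2) :
    diagram_move K [seq (f p.1, p.2) | p <- K]
| RI (c : crossing) (o : bool) K1 K2 :
    diagram_move (K1 ++ K2) (K1 ++ [:: (c, o); (c, ~~ o)] ++ K2)
| RII (c d : crossing) (o : bool) s K1 K2 K3 of
    c.2 != d.2 & s = [:: (c, ~~ o); (d, ~~ o)] \/
                 s = [:: (d, ~~ o); (c, ~~ o)] :
    diagram_move (K1 ++ K2 ++ K3) (K1 ++ [:: (c, o); (d, o)] ++ K2 ++ s ++ K3)
| RIII (x y z : crossing) (t m b : bool) s1 s2 s3 K1 K2 K3 K4 of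
    x.2 (+) b = y.2 (+) m & y.2 (+) m = z.2 (+) t &
    perm_eq [:: s1; s2; s3]
      [:: directed t [:: (x, true); (y, true)];
          directed m [:: (x, false); (z, true)];
          directed b [:: (y, false); (z, false)]] :
    diagram_move (K1 ++ s1 ++ K2 ++ s2 ++ K3 ++ s3 ++ K4)
         (K1 ++ rev s1 ++ K2 ++ rev s2 ++ K3 ++ rev s3 ++ K4).

Definition equivalent : diagram -> diagram -> Prop :=
  clos_refl_sym_trans diagram (fun K L => diagram_move (code K) (code L)).

Record knotoid := Knotoid {
  diagram_of :> diagram -> Prop;
  knotoid_class : exists K, forall L, diagram_of L <-> equivalent K L }.

(* The map formed by K and a shortcut a, met by K as listed in w, where s lists
   the signs of the intersections along a.  The left summand contains the
   half-edges of K, the right one those of a.  At an intersection, K crosses a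
   from the right to the left exactly when it would be a positive crossing with
   a as its upper strand. *)
Section Shortcut.

Variables (w : seq item) (s : seq bool).

Definition shortcut_dart := (dart w + 'I_(size s).+1 * bool)%type.

Definition shortcut_edge (d : shortcut_dart) : shortcut_dart :=
  match d with
  | inl d => inl (strand_edge d)
  | inr d => inr (strand_edge d)
  end.

Definition shortcut_rot (d : shortcut_dart) : shortcut_dart :=
  match d with
  | inl d =>
    match item_at d.1 with
    | None => inr (ord0, d.2)
    | Some (inl _) => inl (strand_rot d)
    | Some (inr j) => inr (inord j.+1, turn false (nth true s j) d.2)
    end
  | inr d =>
    if val d.1 is j.+1
    then inl (place w (inr j), turn true (nth true s j) d.2)
    else inl (ord0, d.2)
  end.

End Shortcut.

Definition pass_of (x : item) : option pass := if x is inl p then Some p else None.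
Definition rank_of (x : item) : option nat := if x is inr j then Some j else None.

Record shortcut_diagram := ShortcutDiagram {
  base : diagram;
  items : seq item;
  signs : seq bool;
  items_base : pmap pass_of items = code base;
  items_signs : perm_eq (pmap rank_of items) (iota 0 (size signs));
  shortcut_spherical :
    spherical (@shortcut_rot items signs) (@shortcut_edge items signs) }.

Definition h_plus (Ka : shortcut_diagram) : nat := count id (signs Ka).
Definition h_minus (Ka : shortcut_diagram) : nat := count negb (signs Ka).

Definition represents (Ka : shortcut_diagram) (k : knotoid) : Prop := k (base Ka).

(* By convention, 0 for the empty set. *)
Definition min_set (S : set nat) : nat :=
  xget 0 [set h | S h /\ forall h', S h' -> h <= h']%classic.

Definition height_plus (k : knotoid) : nat :=
  min_set [set h | exists2 Ka, represents Ka k & h_plus Ka = h]%classic.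
Definition height_minus (k : knotoid) : nat :=
  min_set [set h | exists2 Ka, represents Ka k & h_minus Ka = h]%classic.

Local Open Scope ring_scope.

(* A state is a function from the crossings of K; true = + and false = -. *)
Definition state (K : seq pass) := {ffun seq_sub (crossings K) -> bool}.

Definition state_at K (s : state K) (c : crossing) : bool :=
  if insub c is Some c' then s c' else true.

Section Smoothing.

Variables (K : seq pass) (s : state K) (w : seq item).

(* The half-edge joined to d at its vertex in the s-smoothing of K.  The regions
   swept out when the overstrand rotates counterclockwise lie between the
   overstrand half-edges and the understrand half-edges which follow them
   counterclockwise.  Joining these regions connects every understrand half-edge
   to the next (overstrand) one counterclockwise, and the other smoothing
   connects every overstrand half-edge to the next one.  At a crossing,
   strand_rot has order 4, so that its third power is its inverse.  The
   smoothing goes straight through the intersections with a, and its interval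
   component is closed up by joining v1 to v0. *)
Definition smoothing (d : dart w) : dart w :=
  match item_at d.1 with
  | Some (inl (c, o)) =>
      if state_at s c (+) o then strand_rot d
      else strand_rot (strand_rot (strand_rot d))
  | _ => (d.1, ~~ d.2)
  end.

(* The number of circles, apart from the closed up interval component. *)
Definition loops : nat :=
  (n_comp (fun d e : dart w => (e == strand_edge d) || (e == smoothing d)) predT).-1.

(* The half-edges from which one departs along an edge when following the
   interval component from v0 to v1. *)
Definition on_interval (d : dart w) : bool :=
  fconnect (@smoothing \o @strand_edge (size w)) (ord0, false) d.

(* a(s): traversed as in K, an intersection with a has the same sign as for K,
   and the opposite sign if traversed backwards. *)
Definition interval_number (e : seq bool) : int :=
  \sum_(i < (size w).+1)
    if item_at i is Some (inr j)
    then sign (nth true e j) *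
         ((on_interval (i, false))%:Z - (on_interval (i, true))%:Z)
    else 0.

Definition state_number : int := \sum_c sign (s c).

End Smoothing.

Definition bracket (Ka : shortcut_diagram) : laurent :=
  let K := code (base Ka) in
  \sum_(s : state K)
    varA ^ state_number s * varu ^ interval_number s (items Ka) (signs Ka)
      * (- varA ^ 2 - varA ^ (- 2)) ^+ loops s (items Ka).

Definition normalized_bracket (Ka : shortcut_diagram) : laurent :=
  (- varA) ^ (- 3 * writhe (code (base Ka)))
    * varu ^ (- ((h_plus Ka)%:Z - (h_minus Ka)%:Z)) * bracket Ka.

(* The common value of the normalized bracket on the shortcut diagrams
   representing k; their existence and the independence of the choice are facts
   about knotoids, not part of the definition. *)
Definition turaev (k : knotoid) : laurent :=
  xget 0 [set p | exists2 Ka, represents Ka k & normalized_bracket Ka = p]%classic.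

(* Main.v *)
(* The exponent a(s) - a(K) of u in the contribution of a state s is the
   intersection number of a with the 1-cycle I - K, where I is the interval of
   the s-smoothing.  Since 1-cycles on the sphere bound, the shortcut a may be
   replaced by the copy K' of K pushed off to the right, which has intersection
   number 0 with K: the exponent is I . K', a sum of contributions of the turns
   of I at the crossings, and makes sense for every signed Gauss code, planar or
   not.  With this exponent, the normalized bracket is invariant under all
   Reidemeister moves of Gauss codes, because the skein expansions of the two
   tangles of each move have the same coefficients.  Hence the bracket of one
   shortcut diagram computes the polynomial of the knotoid, and the bounds
   follow from -(h_+ + h_-) <= a(s) <= h_+ + h_- and a(K) = h_+ - h_-. *)

From HB Require Import structures.
Require Import Defs.
From mathcomp Require Import all_boot all_order all_algebra.
From mathcomp Require Import finmap monalg.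
From mathcomp Require Import boolp classical_sets.
From mathcomp Require Import zify ring.

Set Implicit Arguments.
Unset Strict Implicit.
Unset Printing Implicit Defensive.

Import Order.TTheory GRing.Theory Num.Theory.
Local Open Scope ring_scope.

(** * Systems of weighted arcs *)

(** Invariance under the moves is local, but the number of circles of a smoothing and the length of
    its interval are global. The bridge is a list of weighted arcs between half-edges: contracting a
    bivalent point and deleting an isolated loop change the pair (circles, length) in a controlled
    way, whatever the rest of the list is. A tangle can thus be reduced to arcs between its cut
    points in an arbitrary context, and each move becomes a finite identity between expansions of
    model tangles with crossings labelled 0, 1, 2, decided by computation for all signs and
    directions. Passing from [a] to K' is what makes this possible: the weights of I . K' sit on the
    turns at crossings, whereas a(s) depends on where the shortcut runs. The price is the
    homological comparison of the two, where sphericity enters. Euler's formula being an equality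
    between numbers of orbits, that comparison is a count of dimensions of spaces of rational
    functions on half-edges. *)

Definition arc (P : Type) := (P * P * int)%type.

Section Evaluation.

Variables (P : eqType) (v0 v1 : P).

Implicit Types (a : arc P) (L : seq (arc P)) (A : P -> Prop).

Definition flip a : arc P := (a.1.2, a.1.1, - a.2).

(** Two lists with the same [link] are the same arc system, whatever the order and direction in
    which arcs are listed. *)
Definition link L a := (a \in L) || (flip a \in L).

Definition points L := flatten [seq [:: a.1.1; a.1.2] | a <- L].

Definition closed_under L A := forall a, a \in L -> A a.1.1 <-> A a.1.2.

(** Connectedness, expressed by closed predicates instead of paths: when the list of arcs changes,
    it suffices to translate predicates. *)
Definition linked L p q := forall A, closed_under L A -> A p -> A q.

(* [g] numbers the components, the interval being number 0, and [f] is the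
   algebraic length of the interval from its tail; each of the conditions only
   depends on the set of arcs. *)
Definition evaluates_with (g : P -> nat) (f : P -> int) L k n :=
  [/\ forall a, a \in L -> g a.1.1 = g a.1.2,
      forall a, a \in L -> g a.1.1 = 0%N -> f a.1.2 = f a.1.1 + a.2,
      [/\ v0 \in points L, v1 \in points L, g v0 = 0%N & g v1 = 0%N] /\
      (f v0 = 0 /\ f v1 = n),
      (forall i, (i <= k)%N <-> exists2 p, p \in points L & g p = i) &
      forall p q, p \in points L -> q \in points L -> g p = g q -> linked L p q].

(** [k] counts the components other than the interval. This is a relation because a list has no
    value if its ends lie in different components or if the weights on its interval are
    inconsistent. *)
Definition evaluates L (k : nat) (n : int) := exists g f, evaluates_with g f L k n.

Lemma flipK : involutive flip.
Proof. by case=> [[x y] n]; rewrite /flip /= opprK. Qed.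

Lemma mem_points L p :
  reflect (exists2 a, a \in L & (p == a.1.1) || (p == a.1.2)) (p \in points L).
Proof.
apply: (iffP flatten_mapP) => -[a aL pa]; exists a => //; move: pa;
  by rewrite !inE.
Qed.

Lemma points_arc L a : a \in L -> (a.1.1 \in points L) * (a.1.2 \in points L).
Proof. by move=> aL; split; apply/mem_points; exists a; rewrite ?eqxx ?orbT. Qed.

Lemma points_cons a L : points (a :: L) = [:: a.1.1, a.1.2 & points L].
Proof. by []. Qed.

Lemma points_cat L L' : points (L ++ L') = points L ++ points L'.
Proof. by rewrite /points map_cat flatten_cat. Qed.

Lemma linked_refl L p : linked L p p. Proof. by []. Qed.

Lemma linked_trans L q p r : linked L p q -> linked L q r -> linked L p r.
Proof. by move=> pq qr A cA /(pq A cA); apply: qr. Qed.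

Lemma linked_sym L p q : linked L p q -> linked L q p.
Proof.
move=> pq A cA Aq; apply: contrapT => nAp.
by have [] := pq (fun r => ~ A r) _ nAp; first by move=> a /cA ->.
Qed.

Lemma linked_arc L a : a \in L -> linked L a.1.1 a.1.2.
Proof. by move=> aL A cA; rewrite (cA a). Qed.

(** Choosing a point in every component of one numbering gives an injection into the other
    numbering, whence [k = k']. For the lengths, agreement of the two functions propagates along
    arcs from [v0] to [v1]. *)
Lemma evaluates_inj L k n k' n' :
  evaluates L k n -> evaluates L k' n' -> k = k' /\ n = n'.
Proof.
move=> [g [f [gL fL [[v0L v1L g0 g1] [f0 f1]] gk gc]]].
move=> [g' [f' [gL' fL' [[_ _ g0' g1'] [f0' f1']] gk' gc']]].
have le_card j j' (h h' : P -> nat) :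
    (forall a, a \in L -> h' a.1.1 = h' a.1.2) ->
    (forall p q, p \in points L -> q \in points L -> h p = h q -> linked L p q) ->
    (forall i, (i <= j)%N <-> exists2 p, p \in points L & h p = i) ->
    (forall i, (i <= j')%N <-> exists2 p, p \in points L & h' p = i) ->
    (j' <= j)%N.
  move=> hL' hc hj hj'.
  have [i|r rP] := choice (P := fun i p =>
      (i <= j')%N -> p \in points L /\ h' p = i).
    case: (leqP i j') => [/hj' [p pL hp]|_]; last by exists v0.
    by exists p.
  pose t (i : 'I_j'.+1) : 'I_j.+1 := inord (h (r i)).
  have ht (i : 'I_j'.+1) : (h (r i) < j.+1)%N.
    by rewrite ltnS; apply/hj; exists (r i) => //; case: (rP i _); rewrite -1?ltnS.
  suff inj_t : injective t by have := leq_card t inj_t; rewrite !card_ord ltnS.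
  move=> i1 i2 /(congr1 val) /=; rewrite !inordK // => e; apply: val_inj => /=.
  have [|p1L <-] := rP i1; first by rewrite -ltnS.
  have [|p2L <-] := rP i2; first by rewrite -ltnS.
  have cl : closed_under L (fun q => h' (r i1) = h' q) by move=> a /hL' ->.
  exact: (hc _ _ p1L p2L e _ cl erefl).
split.
  apply/eqP; rewrite eqn_leq.
  by rewrite (le_card k' k g' g) ?(le_card k k' g g').
have lv : linked L v0 v1 by apply: gc => //; rewrite g0.
pose A p := [/\ g p = 0%N, g' p = 0%N & f p = f' p].
have [||_ _] := lv A; rewrite /A ?g0 ?f0 ?f0' //; last by rewrite f1 f1'.
move=> a aL; rewrite /A -(gL a) // -(gL' a) //; split=> -[ga ga' e]; split=> //.
  by rewrite fL // fL' // e.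
by move: e; rewrite fL // fL' //; apply: addIr.
Qed.

Lemma link_flip L a : link L (flip a) = link L a.
Proof. by rewrite /link flipK orbC. Qed.

Lemma link_points L M :
  link L =1 link M -> points L =i points M.
Proof.
have sub L1 L2 :
    link L1 =1 link L2 -> {subset points L1 <= points L2}.
  move=> eL p /mem_points [a aL pa].
  have : link L2 a by rewrite -eL /link aL.
  case/orP=> aM'; apply/mem_points; first by exists a.
  by exists (flip a) => //=; rewrite orbC.
by move=> eL p; apply/idP/idP; apply: sub.
Qed.

Lemma evaluates_link_imp L L' k n :
  link L =1 link L' -> evaluates L k n -> evaluates L' k n.
Proof.
move=> eL [g [f [gL fL vL gk gc]]]; exists g, f.
have LP a : a \in L' -> a \in L \/ flip a \in L.
  by move=> aL'; apply/orP; rewrite -/(link _ _) eL /link aL'.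
have pLL' := link_points eL.
have clLL' A : closed_under L' A -> closed_under L A.
  move=> cA a aL; have : link L' a by rewrite -eL /link aL.
  by case/orP => /cA //= [? ?]; split.
split.
- by move=> a /LP [/gL //|/gL /=].
- move=> a /LP [/[dup] /gL e /fL //|]; move=> /[dup] /gL /= e /fL /= h ga.
  by rewrite h ?e // subrK.
- by rewrite -!pLL'.
- by move=> i; rewrite gk; split=> -[p pL gp]; exists p; rewrite ?pLL' // -pLL'.
- move=> p q; rewrite -!pLL' => pL qL gpq A cA.
  exact: gc (clLL' A cA).
Qed.

(** [p] is bivalent and not an end, so suppressing it neither merges nor creates components. To put
    it back, [p] inherits the component of [x] and the length [f x + n1]. *)
Lemma evaluates_contract L x y p k n n1 n2 :
  p \notin points L -> p != x -> p != y -> p != v0 -> p != v1 ->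
  evaluates [:: (x, p, n1), (p, y, n2) & L] k n <->
  evaluates ((x, y, n1 + n2) :: L) k n.
Proof.
move=> pL px py pv0 pv1.
have pa a : a \in L -> (a.1.1 == p = false) * (a.1.2 == p = false).
  move=> aL; have [a1 a2] := points_arc aL.
  by split; apply: contraNF pL => /eqP <-.
have pts q : (q \in points [:: (x, p, n1), (p, y, n2) & L]) =
             (q == p) || (q \in points ((x, y, n1 + n2) :: L)).
  rewrite !points_cons !inE /=; do !case: (_ == _) => //=.
split=> -[g [f [gL fL [[v0L v1L g0 g1] f01] gk gc]]].
- have gxp : g x = g p by apply: (gL (x, p, n1)); rewrite !inE eqxx.
  have gpy : g p = g y by apply: (gL (p, y, n2)); rewrite !inE eqxx ?orbT.
  exists g, f; split.
  + move=> a; rewrite inE => /predU1P [-> /=|aL]; first by rewrite gxp.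
    by apply: gL; rewrite !inE aL !orbT.
  + move=> a; rewrite inE => /predU1P [-> /= gx|aL].
      have /= -> := fL (p, y, n2); rewrite ?inE ?eqxx ?orbT -?gxp //.
      have /= -> := fL (x, p, n1); rewrite ?inE ?eqxx ?orbT //.
      by rewrite addrA.
    by apply: fL; rewrite !inE aL !orbT.
  + move: v0L v1L; rewrite !pts eq_sym (negPf pv0) /=.
    by rewrite eq_sym (negPf pv1) /=.
  + move=> i; rewrite gk; split=> -[q qL gq].
      move: qL; rewrite pts => /predU1P [eq|]; last by exists q.
      by exists x; rewrite ?points_cons ?inE ?eqxx //= gxp -eq.
    by exists q => //; rewrite pts qL orbT.
  + move=> q r qL rL gqr A cA.
    have cA' : closed_under [:: (x, p, n1), (p, y, n2) & L]
        (fun s => if s == p then A x else A s).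
      move=> a; rewrite !inE => /or3P [/eqP->|/eqP->|aL] /=.
      * by rewrite eqxx eq_sym (negPf px).
      * rewrite eqxx eq_sym (negPf py).
        by have := cA (x, y, n1 + n2); apply; rewrite inE eqxx.
      * by rewrite !pa //; apply: cA; rewrite inE aL orbT.
    have := gc q r _ _ gqr _ cA'.
    rewrite !pts qL rL !orbT => /(_ erefl erefl).
    have np s : s \in points ((x, y, n1 + n2) :: L) -> (s == p) = false.
      rewrite points_cons !inE /= => /or3P [/eqP->|/eqP->|sL].
      * by rewrite eq_sym (negPf px).
      * by rewrite eq_sym (negPf py).
      * by apply: contraNF pL => /eqP <-.
    by rewrite !np.
- have gxy : g x = g y by apply: (gL (x, y, n1 + n2)); rewrite inE eqxx.
  exists (fun q => if q == p then g x else g q).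
  exists (fun q => if q == p then f x + n1 else f q); split.
  + move=> a; rewrite !inE => /or3P [/eqP->|/eqP->|aL] /=.
    * by rewrite eqxx eq_sym (negPf px).
    * by rewrite eqxx eq_sym (negPf py).
    * by rewrite !pa //; apply: gL; rewrite inE aL orbT.
  + move=> a; rewrite !inE => /or3P [/eqP->|/eqP->|aL] /=.
    * by rewrite eqxx eq_sym (negPf px).
    * rewrite eqxx eq_sym (negPf py) => gx.
      by have /= -> := fL (x, y, n1 + n2); rewrite ?inE ?eqxx // addrA.
    * by rewrite !pa //; apply: fL; rewrite inE aL orbT.
  + rewrite !pts v0L v1L !orbT.
    by rewrite ![_ == p]eq_sym (negPf pv0) (negPf pv1).
  + move=> i; rewrite gk; split=> -[q qL gq].
      exists q; first by rewrite pts qL orbT.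
      rewrite ifN //; apply: contraTneq qL => ->.
      by rewrite points_cons !inE /= !negb_or px py.
    move: qL gq; rewrite pts; case: eqP => [_ _ gx|_ qL gq].
      by exists x => //; rewrite points_cons inE eqxx.
    by exists q.
  + have lk q r : linked ((x, y, n1 + n2) :: L) q r ->
                  linked [:: (x, p, n1), (p, y, n2) & L] q r.
      move=> lqr A cA; apply: lqr => a; rewrite inE => /predU1P [->|aL] /=.
        apply: (iff_trans (B := A p)).
          by apply: (cA (x, p, n1)); rewrite !inE eqxx.
        by apply: (cA (p, y, n2)); rewrite !inE eqxx orbT.
      by apply: cA; rewrite !inE aL !orbT.
    have lxp : linked [:: (x, p, n1), (p, y, n2) & L] x p.
      by apply: (linked_arc (a := (x, p, n1))); rewrite !inE eqxx.
    have xL : x \in points ((x, y, n1 + n2) :: L) by rewrite inE eqxx.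
    move=> q r; rewrite !pts.
    case: eqP => [-> _|_ /= qL]; case: eqP => [-> _|_ /= rL] e.
    * exact: linked_refl.
    * by apply: (linked_trans (linked_sym lxp)); apply: lk; apply: gc.
    * by apply: (linked_trans _ lxp); apply: lk; apply: gc.
    * by apply: lk; apply: gc.
Qed.

Lemma evaluates_loop L p k n n1 :
  p \notin points L -> p != v0 -> p != v1 ->
  evaluates ((p, p, n1) :: L) k.+1 n <-> evaluates L k n.
Proof.
move=> pL pv0 pv1.
have pa q : q \in points L -> q == p = false.
  by move=> qL; apply: contraNF pL => /eqP <-.
have pts q : (q \in points ((p, p, n1) :: L)) = (q == p) || (q \in points L).
  by rewrite points_cons !inE /= orbA orbb.
have clp A : closed_under L A -> closed_under ((p, p, n1) :: L) A.
  by move=> cA a; rewrite inE => /predU1P [->|/cA].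
split=> -[g [f [gL fL [[v0L v1L g0 g1] f01] gk gc]]].
- have gp q : q \in points L -> g q != g p.
    move=> qL; apply/eqP => gqp; case/negP: pL.
    apply: (gc q p _ _ gqp (fun r => r \in points L)) => //.
    + by rewrite pts qL orbT.
    + by rewrite pts eqxx.
    + by move=> a; rewrite inE => /predU1P [->//|/points_arc [-> ->]].
  have gpk : (g p <= k.+1)%N by apply/gk; exists p; rewrite ?pts ?eqxx.
  have gp0 : g p != 0%N.
    rewrite -g0 eq_sym gp //; move: v0L; rewrite pts eq_sym.
    by rewrite (negPf pv0).
  (* The loop may bear any positive number. This transposition gives it the number [k.+1], so that
     the others fill 0, ..., k, and it fixes 0, the number of the interval. *)
  pose sw i := if i == g p then k.+1 else if i == k.+1 then g p else i.
  have swK : involutive sw by rewrite /sw => i; do !case: eqP => //; lia.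
  have swI := inv_inj swK.
  have sw0 : sw 0%N = 0%N by rewrite /sw eq_sym (negPf gp0).
  exists (sw \o g), f; split.
  + by move=> a aL /=; rewrite gL // inE aL orbT.
  + move=> a aL /=; rewrite -sw0 => /swI; apply: fL.
    by rewrite inE aL orbT.
  + move: v0L v1L; rewrite !pts eq_sym (negPf pv0) eq_sym (negPf pv1) /=.
    by rewrite g0 g1 sw0.
  + move=> i; split=> [le_ik|[q qL <-] /=].
      have [q] : exists2 q, q \in points ((p, p, n1) :: L) & g q = sw i.
        by apply/gk; rewrite /sw; do !case: eqP => //; lia.
      rewrite pts => /predU1P [-> e|qL e].
        have : sw (sw i) = k.+1 by rewrite -e /sw eqxx.
        by rewrite swK; lia.
      by exists q => //=; rewrite e swK.
    have : (g q <= k.+1)%N by apply/gk; exists q; rewrite // pts qL orbT.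
    have := gp q qL; rewrite /sw; do !case: eqP => //; lia.
  + move=> q r qL rL /= /swI gqr A cA.
    by apply: gc (clp A cA); rewrite ?pts ?qL ?rL ?orbT.
- exists (fun q => if q == p then k.+1 else g q), f; split.
  + move=> a; rewrite inE => /predU1P [-> //|aL].
    by rewrite !pa ?(points_arc aL) // gL.
  + move=> a; rewrite inE => /predU1P [-> /=|aL]; first by rewrite eqxx.
    by rewrite !pa ?(points_arc aL) //; apply: fL.
  + by rewrite !pts v0L v1L !orbT [v0 == p]eq_sym [v1 == p]eq_sym (negPf pv0)
    (negPf pv1).
  + move=> i; split.
      rewrite leq_eqVlt ltnS => /predU1P [->|/gk [q qL <-]].
        by exists p; rewrite ?pts eqxx.
      by exists q; rewrite ?pts ?qL ?orbT // pa.
    case=> q; rewrite pts; case: eqP => [_ _ <- //|_ /= qL gq].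
    by apply: leqW; apply/gk; exists q.
  + have gk' q : q \in points L -> (g q <= k)%N by move=> qL; apply/gk; exists q.
    move=> q r; rewrite !pts.
    case: eqP => [-> _|_ /= qL]; case: eqP => [-> _|_ /= rL] e.
    * exact: linked_refl.
    * by have := gk' r rL; rewrite -e ltnn.
    * by have := gk' q qL; rewrite e ltnn.
    * move=> A cA; apply: (gc q r) => // a aL; apply: cA.
      by rewrite inE aL orbT.
Qed.

(** The equivalence for a loop covers positive numbers of circles only; this excludes the remaining
    case when a list without value is compared with the same list plus a loop. *)
Lemma evaluates_loop_pos L p n n1 :
  p \notin points L -> p != v0 -> ~ evaluates ((p, p, n1) :: L) 0 n.
Proof.
move=> pL pv0 [g [f [gL fL [[v0L v1L g0 g1] f01] gk gc]]].
have gp : g p = g v0.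
  rewrite g0; apply/eqP; rewrite -leqn0; apply/gk; exists p => //.
  by rewrite inE eqxx.
suff : p != p by rewrite eqxx.
apply: (gc v0 p v0L _ (esym gp) (fun r => r != p)).
- by rewrite inE eqxx.
- move=> a; rewrite inE => /predU1P [-> //|/points_arc [a1 a2]].
  by split=> _; apply: contraNneq pL => <-.
- by rewrite eq_sym.
Qed.

End Evaluation.

(** Numbering and length pull back along [h], hence the direction of the implication. Connectedness
    comes back because [h] identifies no two points of [L], so that the image of a closed predicate
    is closed. *)
Lemma evaluates_map (P Q : eqType) (h : P -> Q) v0 v1 (L : seq (arc P)) k n :
  {in points L &, injective h} -> v0 \in points L -> v1 \in points L ->
  evaluates (h v0) (h v1) [seq (h a.1.1, h a.1.2, a.2) | a <- L] k n ->
  evaluates v0 v1 L k n.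
Proof.
move=> hI v0L v1L [g [f [gL fL [[_ _ g0 g1] f01] gk gc]]].
have pts q : q \in points [seq (h a.1.1, h a.1.2, a.2) | a <- L] <->
             exists2 p, p \in points L & h p = q.
  split=> [/mem_points [_ /mapP [a aL ->] /= /orP [] /eqP ->]|].
  - by exists a.1.1 => //; case: (points_arc aL).
  - by exists a.1.2 => //; case: (points_arc aL).
  - case=> p /mem_points [a aL pa] <-; apply/mem_points.
    exists (h a.1.1, h a.1.2, a.2); first exact: map_f.
    by case/orP: pa => /eqP ->; rewrite eqxx ?orbT.
have mapL a : a \in L -> (h a.1.1, h a.1.2, a.2) \in
    [seq (h a.1.1, h a.1.2, a.2) | a <- L].
  exact: (map_f (fun a : arc P => (h a.1.1, h a.1.2, a.2))).
exists (g \o h), (f \o h); split=> //.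
- by move=> a /mapL /gL.
- by move=> a /mapL /fL.
- move=> i; rewrite gk; split=> [[q /pts [p pL <-] gp]|[p pL gp]].
    by exists p.
  by exists (h p) => //; apply/pts; exists p.
- move=> p q pL qL e A cA Ap.
  suff [s sL [e' As]] : exists2 s, s \in points L & h s = h q /\ A s.
    by rewrite -(hI s q sL qL e').
  apply: (gc (h p) (h q) _ _ e (fun r => exists2 s, s \in points L & h s = r /\ A s)).
  + by apply/pts; exists p.
  + by apply/pts; exists q.
  + move=> _ /mapP [a aL ->] /=; have [a1 a2] := points_arc aL.
    split=> -[s sL [e' As]].
      by exists a.1.2 => //; split=> //; apply/(cA a aL); rewrite -(hI s a.1.1).
    by exists a.1.1 => //; split=> //; apply/(cA a aL); rewrite -(hI s a.1.2).
  + by exists p.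
Qed.

(** * Skein expansions *)

(* [(Some x, b)] is a half-edge at the item [x], entering it if [b] holds. *)
Definition point := (option item * bool)%type.
Definition start : point := (None, false).
Definition finish : point := (None, true).
(* The points at which the strands of a tangle are cut off from the rest of a
   diagram; codes have no items [inr j]. *)
Definition dummy (j : nat) : point := (Some (inr j), true).

Fixpoint strand (a : point) (w : seq item) (b : point) : seq (arc point) :=
  if w is x :: w' then (a, (Some x, true), 0) :: strand (Some x, false) w' b
  else [:: (a, b, 0)].

(* 1 for the half-edges at a crossing lying to the right of the copy K' of K
   pushed off to the right, and 0 for the other ones; a turn at the crossing
   crosses K' from the right to the left as often as the height decreases. *)
Definition height (p : pass) (x : bool) : int :=
  (x (+) (p.2 (+) ~~ p.1.2) : nat)%:Z.

Definition smooth_arc (b : bool) (c : crossing) (x : bool) : arc point :=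
  ((Some (inl (c, false)), x), (Some (inl (c, true)), x (+) c.2 (+) ~~ b),
   height (c, false) x - height (c, true) (x (+) c.2 (+) ~~ b)).

Definition smooth_arcs (b : bool) (c : crossing) : seq (arc point) :=
  [:: smooth_arc b c true; smooth_arc b c false].
Arguments smooth_arcs : simpl never.

Section Reduction.

Variable P : eqType.
Implicit Types (L : seq (arc P)) (p : P).

Fixpoint take_at p L : option (P * int * seq (arc P)) :=
  if L is a :: L' then
    if a.1.1 == p then Some (a.1.2, a.2, L')
    else if a.1.2 == p then Some (a.1.1, - a.2, L')
    else if take_at p L' is Some (y, n, M) then Some (y, n, a :: M) else None
  else None.

(** The list is returned unchanged unless [p] is an isolated loop or a bivalent point; these tests
    make the reduction sound on every input. The boolean records a deleted circle, whose weight is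
    dropped since only the interval is measured. *)
Definition eliminate p L : bool * seq (arc P) :=
  if take_at p L is Some (y, n, L1) then
    if y == p then if p \notin points L1 then (true, L1) else (false, L)
    else if take_at p L1 is Some (z, m, L2) then
      if (p \notin points L2) && (z != p) then (false, (y, z, - n + m) :: L2)
      else (false, L)
    else (false, L)
  else (false, L).

Fixpoint eliminates (ps : seq P) L : nat * seq (arc P) :=
  if ps is p :: ps' then
    let: (b, L') := eliminate p L in let: (k, M) := eliminates ps' L' in
    ((b + k)%N, M)
  else (0%N, L).

End Reduction.

(** [(n, e, M)] stands for n A^e times the arc system [M]. *)
Definition term := (int * int * seq (arc point))%type.

(* Cut points are numbered from 0 to 5. *)
Definition point_code (p : point) : nat :=
  if p is (Some (inr j), _) then j else 6.

Definition orient (a : arc point) :=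
  if (point_code a.1.1 <= point_code a.1.2)%N then a else flip a.

(** Once the half-edges at crossings are eliminated, arcs join cut points, and sorting turns equal
    systems into equal lists. The factor 10 exceeds the codes of the cut points, so that the key
    determines both ends. *)
Definition canonical (L : seq (arc point)) :=
  sort (relpre (fun a : arc point => point_code a.1.1 * 10 + point_code a.1.2)%N leq)
    (map orient L).

Fixpoint times_delta k (ts : seq term) : seq term :=
  if k is k'.+1 then
    times_delta k' ([seq (- t.1.1, t.1.2 + 2, t.2) | t <- ts]
                 ++ [seq (- t.1.1, t.1.2 - 2, t.2) | t <- ts])
  else ts.

(* A computable version of [skein] below, for concrete tangles. *)
Fixpoint expansion ps (cs : seq crossing) (L : seq (arc point)) : seq term :=
  if cs is c :: cs' then
    [seq (t.1.1, t.1.2 + 1, t.2) | t <- expansion ps cs' (smooth_arcs true c ++ L)]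
    ++ [seq (t.1.1, t.1.2 - 1, t.2)
         | t <- expansion ps cs' (smooth_arcs false c ++ L)]
  else
    let: (k, M) := eliminates ps L in times_delta k [:: (1, 0, canonical M)].

Definition coefficient (ts : seq term) (x : int * seq (arc point)) : int :=
  foldr (fun t n => if (t.1.2, t.2) == x then t.1.1 + n else n) 0 ts.

Definition same_terms (ts us : seq term) :=
  all (fun t : term => coefficient ts (t.1.2, t.2) == coefficient us (t.1.2, t.2))
    (ts ++ us).

Definition half_edges (cs : seq crossing) : seq point :=
  [seq (Some (inl (co.1, co.2.1)), co.2.2) | co <-
     [seq (c, o) | c <- cs,
        o <- [:: (true, true); (true, false); (false, true); (false, false)]]].

Fixpoint strands_from (i : nat) (ss : seq (seq pass)) : seq (arc point) :=
  if ss is s :: ss' then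
    strand (dummy (2 * i)) (map inl s) (dummy (2 * i).+1) ++ strands_from i.+1 ss'
  else [::].

Definition tangle_terms (cs : seq crossing) (ss : seq (seq pass)) :=
  expansion (half_edges cs) cs (strands_from 0 ss).

Definition scale_terms (n e : int) (ts : seq term) : seq term :=
  [seq (n * t.1.1, t.1.2 + e, t.2) | t <- ts].

(** Kauffman's factor of a kink, with no power of u: arcs are compared together with their weights,
    so the computation also shows that the turning weights along the strand cancel. *)
Lemma RI_terms p o : let c := (0%N, p) in
  same_terms (tangle_terms [:: c] [:: [:: (c, o); (c, ~~ o)]])
             (scale_terms (-1) (3 * sign p) (tangle_terms [::] [:: [::]])).
Proof. by case: p; case: o; vm_compute. Qed.

Lemma RII_terms p o r : let c := (0%N, p) in let d := (1%N, ~~ p) in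
  let s := if r then [:: (c, ~~ o); (d, ~~ o)] else [:: (d, ~~ o); (c, ~~ o)] in
  same_terms (tangle_terms [:: c; d] [:: [:: (c, o); (d, o)]; s])
             (scale_terms 1 0 (tangle_terms [::] [:: [::]; [::]])).
Proof. by case: p; case: o; case: r; vm_compute. Qed.

Definition triangle (x y z : crossing) (t m b : bool) : seq (seq pass) :=
  [:: directed t [:: (x, true); (y, true)]; directed m [:: (x, false); (z, true)];
      directed b [:: (y, false); (z, false)]].

(** A code may run through the three strands in any order, hence the permutations; the two equations
    select the signs and directions for which the triangle is a face. *)
Lemma RIII_terms px py pz t m b ss :
  let x := (0%N, px) in let y := (1%N, py) in let z := (2%N, pz) in
  px (+) b = py (+) m -> py (+) m = pz (+) t ->
  ss \in permutations (triangle x y z t m b) ->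
  same_terms (tangle_terms [:: x; y; z] ss)
             (scale_terms 1 0 (tangle_terms [:: x; y; z] (map rev ss))).
Proof.
move=> x y z; suff: (px (+) b == py (+) m) && (py (+) m == pz (+) t) ==>
    all (fun ss => same_terms (tangle_terms [:: x; y; z] ss)
           (scale_terms 1 0 (tangle_terms [:: x; y; z] (map rev ss))))
        (permutations (triangle x y z t m b)).
  by move=> /implyP h e1 e2; move: ss; apply/allP/h; rewrite e1 e2 !eqxx.
by rewrite {}/x {}/y {}/z; case: px; case: py; case: pz; case: t; case: m; case: b;
  vm_compute.
Qed.

Definition map_arc (P Q : Type) (h : P -> Q) (a : arc P) : arc Q :=
  (h a.1.1, h a.1.2, a.2).

Lemma link_cat (P : eqType) (L1 L2 : seq (arc P)) a :
  link (L1 ++ L2) a = link L1 a || link L2 a.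
Proof. by rewrite /link !mem_cat orbACA. Qed.

Lemma link_cons (P : eqType) b (L : seq (arc P)) a :
  link (b :: L) a = link [:: b] a || link L a.
Proof. by rewrite -cat1s link_cat. Qed.

Lemma link_perm (P : eqType) (L M : seq (arc P)) :
  perm_eq L M -> link L =1 link M.
Proof. by move=> e a; rewrite /link !(perm_mem e). Qed.

Lemma link_map (P Q : eqType) (h : P -> Q) (L M : seq (arc P)) :
  link L =1 link M -> link (map (map_arc h) L) =1 link (map (map_arc h) M).
Proof.
have sub (L1 L2 : seq (arc P)) : link L1 =1 link L2 ->
    forall a, link (map (map_arc h) L1) a -> link (map (map_arc h) L2) a.
  move=> eL a.
  have mem b : b \in map (map_arc h) L1 -> link (map (map_arc h) L2) b.
    case/mapP=> c cL ->; have : link L2 c by rewrite -eL /link cL.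
    rewrite /link => /orP [] cL2; apply/orP; [left|right].
      exact: map_f.
    exact: (map_f (map_arc h) cL2).
  by case/orP => [/mem //|/mem]; rewrite link_flip.
by move=> eL a; apply/idP/idP; apply: sub.
Qed.

(** * State sums of arc systems *)

Definition delta : laurent := - varA ^ 2 - varA ^ (- 2).

(** The monomial of one state. Lists without value get 0, and the comparisons below hold for them
    too. *)
Definition value (L : seq (arc point)) : laurent :=
  if pselect (exists kn, evaluates start finish L kn.1 kn.2) is left h
  then varu ^ (sval (cid h)).2 * delta ^+ (sval (cid h)).1 else 0.

Lemma valueE L k n : evaluates start finish L k n -> value L = varu ^ n * delta ^+ k.
Proof.
move=> kn; rewrite /value; case: pselect => [h|[]]; last by exists (k, n).
by have [<- <-] := evaluates_inj kn (svalP (cid h)).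
Qed.

Lemma value_iff L M :
  (forall k n, evaluates start finish L k n <-> evaluates start finish M k n) ->
  value L = value M.
Proof.
move=> e; case: (pselect (exists kn, evaluates start finish L kn.1 kn.2)).
  by case=> -[k n] /= h; rewrite (valueE h) (valueE (proj1 (e k n) h)).
move=> h; rewrite /value; case: pselect => // _; case: pselect => // -[kn kn'].
by case: h; exists kn; apply/e.
Qed.

Lemma value_link L M : link L =1 link M -> value L = value M.
Proof.
by move=> e; apply: value_iff => k n; split; apply: evaluates_link_imp => a.
Qed.

Lemma value_contract L x y p n1 n2 :
  p \notin points L -> p != x -> p != y -> p != start -> p != finish ->
  value [:: (x, p, n1), (p, y, n2) & L] = value ((x, y, n1 + n2) :: L).
Proof. by move=> *; apply: value_iff => k n; apply: evaluates_contract. Qed.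

Lemma value_loop L p n :
  p \notin points L -> p != start -> p != finish ->
  value ((p, p, n) :: L) = delta * value L.
Proof.
move=> pL p0 p1.
case: (pselect (exists kn, evaluates start finish L kn.1 kn.2)).
  case=> -[k m] /= h; rewrite (valueE h).
  by rewrite (valueE (proj2 (evaluates_loop k m n pL p0 p1) h)) exprS mulrCA.
move=> h; rewrite [in RHS]/value; case: pselect => // _; rewrite mulr0.
rewrite /value; case: pselect => // -[[[|k] m] /=];
  first by case/(evaluates_loop_pos pL p0).
by move=> h'; case: h; exists (k, m); apply/(evaluates_loop k m n pL p0 p1).
Qed.

(** The state sum over [cs], one crossing at a time. Crossings already smoothed and strands of the
    diagram are treated alike, as arcs of [L]. *)
Fixpoint skein (cs : seq crossing) (L : seq (arc point)) : laurent :=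
  if cs is c :: cs' then
    varA * skein cs' (smooth_arcs true c ++ L)
    + varA^-1 * skein cs' (smooth_arcs false c ++ L)
  else value L.

Lemma skein_cons c cs L :
  skein (c :: cs) L = varA * skein cs (smooth_arcs true c ++ L)
                      + varA^-1 * skein cs (smooth_arcs false c ++ L).
Proof. by []. Qed.

Definition half_edge_of (cs : seq crossing) (p : point) : bool :=
  if p is (Some (inl (c, _)), _) then c \in cs else false.

Lemma smooth_points b c p : p \in points (smooth_arcs b c) -> half_edge_of [:: c] p.
Proof. by rewrite /points /= !inE => /or4P [] /eqP -> /=; rewrite inE. Qed.

(** [S] stands for the arcs brought in by smoothing [cs]. All that is known of it is that its points
    are half-edges at these crossings, which is enough to see that other points remain fresh. *)
Lemma skein_scale k cs L M :
  (forall S, {in points S, forall p, half_edge_of cs p} ->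
             value (S ++ L) = k * value (S ++ M)) ->
  skein cs L = k * skein cs M.
Proof.
elim: cs L M => [|c cs IH] L M kLM; first by have /= := kLM [::]; apply.
have half S b : {in points S, forall p, half_edge_of cs p} ->
    {in points (S ++ smooth_arcs b c), forall p, half_edge_of (c :: cs) p}.
  move=> hS p; rewrite points_cat mem_cat => /orP [/hS|/smooth_points].
    by case: p => [[[[d o]|]|]] //= x; rewrite inE => ->; rewrite orbT.
  by case: p => [[[[d o]|]|]] //= x; rewrite !inE => ->.
rewrite !skein_cons (IH (smooth_arcs true c ++ L) (smooth_arcs true c ++ M));
  last first.
  by move=> S hS; rewrite !catA; apply: kLM; apply: half.
rewrite (IH (smooth_arcs false c ++ L) (smooth_arcs false c ++ M)); last first.
  by move=> S hS; rewrite !catA; apply: kLM; apply: half.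
by ring.
Qed.

Lemma skein_eq cs L M :
  (forall S, {in points S, forall p, half_edge_of cs p} ->
             value (S ++ L) = value (S ++ M)) ->
  skein cs L = skein cs M.
Proof.
by move=> e; rewrite (@skein_scale 1 cs L M) ?mul1r // => S hS; rewrite mul1r e.
Qed.

Lemma skein_link cs L M : link L =1 link M -> skein cs L = skein cs M.
Proof.
by move=> e; apply: skein_eq => S _; apply: value_link => a; rewrite !link_cat e.
Qed.

Lemma skein_contract cs L x y p n1 n2 :
  p \notin points L -> p != x -> p != y -> p != start -> p != finish ->
  ~~ half_edge_of cs p ->
  skein cs [:: (x, p, n1), (p, y, n2) & L] = skein cs ((x, y, n1 + n2) :: L).
Proof.
move=> pL px py p0 p1 pcs; apply: skein_eq => S hS.
rewrite (@value_link _ [:: (x, p, n1), (p, y, n2) & S ++ L]); last first.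
  apply: link_perm; rewrite perm_sym.
  by rewrite -![_ :: _ :: _ ++ _]/([:: _; _] ++ _) perm_catCA.
rewrite value_contract //; last first.
  by rewrite points_cat mem_cat negb_or pL andbT; apply: contra pcs => /hS.
by apply: value_link; apply: link_perm; rewrite -cat1s perm_catCA.
Qed.

Lemma skein_loop cs L p n :
  p \notin points L -> p != start -> p != finish -> ~~ half_edge_of cs p ->
  skein cs ((p, p, n) :: L) = delta * skein cs L.
Proof.
move=> pL p0 p1 pcs; apply: skein_scale => S hS.
rewrite (@value_link _ ((p, p, n) :: S ++ L)); last first.
  by apply: link_perm; rewrite -cat1s perm_catCA.
rewrite value_loop // points_cat mem_cat negb_or pL andbT.
by apply: contra pcs => /hS.
Qed.

Lemma skein_cons_mid cs1 c cs2 L :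
  skein (cs1 ++ c :: cs2) L = skein (c :: cs1 ++ cs2) L.
Proof.
elim: cs1 L => [//|d cs1 IH] L.
have sw b b' : skein (cs1 ++ cs2) (smooth_arcs b c ++ smooth_arcs b' d ++ L)
             = skein (cs1 ++ cs2) (smooth_arcs b' d ++ smooth_arcs b c ++ L).
  by apply/skein_link/link_perm; rewrite perm_catCA.
transitivity (varA * skein (cs1 ++ c :: cs2) (smooth_arcs true d ++ L)
    + varA^-1 * skein (cs1 ++ c :: cs2) (smooth_arcs false d ++ L)); first by [].
transitivity (varA * skein (d :: cs1 ++ cs2) (smooth_arcs true c ++ L)
    + varA^-1 * skein (d :: cs1 ++ cs2) (smooth_arcs false c ++ L)); last by [].
rewrite (IH (smooth_arcs true d ++ L)) (IH (smooth_arcs false d ++ L)).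
rewrite (skein_cons c _ (smooth_arcs true d ++ L)).
rewrite (skein_cons c _ (smooth_arcs false d ++ L)).
rewrite (skein_cons d _ (smooth_arcs true c ++ L)).
rewrite (skein_cons d _ (smooth_arcs false c ++ L)).
rewrite !sw; ring.
Qed.

Lemma skein_perm cs cs' L : perm_eq cs cs' -> skein cs L = skein cs' L.
Proof.
elim: cs cs' L => [|c cs IH] cs' L e.
  by move: e; rewrite perm_sym => /perm_nilP ->.
have ccs : c \in cs' by rewrite -(perm_mem e) inE eqxx.
move: e; case/splitPr: ccs => cs1 cs2 e.
rewrite skein_cons_mid (skein_cons c cs) (skein_cons c (cs1 ++ cs2)).
have eq : perm_eq cs (cs1 ++ cs2).
  by rewrite -(perm_cons c) (permPl e) -cat1s perm_catCA.
by rewrite !(IH _ _ eq).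
Qed.

Lemma eq_flip (P : eqType) (a b : arc P) : (flip a == b) = (a == flip b).
Proof. by rewrite -(inj_eq (can_inj (@flipK P))) flipK. Qed.

Lemma link_flip1 (P : eqType) (a b : arc P) : link [:: flip a] b = link [:: a] b.
Proof. by rewrite /link !inE -(eq_flip b a) (eq_flip b (flip a)) flipK orbC. Qed.

Lemma take_atP (P : eqType) (p : P) L y n M :
  take_at p L = Some (y, n, M) -> link L =1 link ((p, y, n) :: M).
Proof.
elim: L M => //= a L IH M; case: eqP => [ap [<- <- <-] | _].
  by have -> : (p, a.1.2, a.2) = a by rewrite -ap; case: (a) => [[]].
case: eqP => [ap [<- <- <-] b | _].
  rewrite link_cons [RHS]link_cons; congr (_ || _).
  by rewrite -ap (_ : (a.1.2, a.1.1, - a.2) = flip a) // link_flip1.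
case: (take_at p L) IH => // -[[z m] M'] IH [ez em <-] b.
rewrite link_cons (IH M') ?ez ?em //.
by rewrite (link_cons _ M') (link_cons _ (a :: M')) (link_cons a M') orbCA.
Qed.

(** * Soundness of the computed expansions *)

Definition rename (r : crossing -> crossing) (p : point) : point :=
  match p with
  | (Some (inl (c, o)), x) => (Some (inl (r c, o)), x)
  | _ => p
  end.

Definition in_tangle (cl : seq crossing) (p : point) : bool :=
  match p with
  | (Some (inl (c, _)), _) => c \in cl
  | (Some (inr _), _) => true
  | (None, _) => false
  end.

Definition term_value (V : seq (arc point) -> laurent) (t : term) : laurent :=
  t.1.1%:~R * varA ^ t.1.2 * V t.2.

Lemma points_map_arc (P Q : eqType) (h : P -> Q) L :
  points (map (map_arc h) L) = map h (points L).
Proof. by elim: L => //= a L IH; rewrite !points_cons /= IH. Qed.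

Lemma in_tangle_half_edge cl p : half_edge_of cl p -> in_tangle cl p.
Proof. by case: p => [[[[]|]|]]. Qed.

Lemma scale_trans (K : nzRingType) (d x y z : K) m n :
  x = d ^+ m * y -> y = d ^+ n * z -> x = d ^+ (m + n) * z.
Proof. by move=> -> ->; rewrite exprD mulrA. Qed.

Section Tangle.

Variables (r : crossing -> crossing) (cl cs : seq crossing) (R : seq (arc point)).

Hypothesis r_inj : {in cl &, injective r}.
Hypothesis R_out : {in points R, forall p, ~~ half_edge_of (map r cl) p}.
Hypothesis cs_out : {in cs, forall c, c \notin map r cl}.

Local Notation phi := (rename r).
Local Notation V := (fun M => skein cs (map (map_arc phi) M ++ R)).

Lemma rename_inj : {in in_tangle cl &, injective phi}.
Proof.
move=> [[[[c o]|j]|] x] [[[[d o']|j']|] x'] //= cP dP [].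
by move=> /r_inj e -> ->; rewrite e.
Qed.

Lemma rename_neq p q :
  in_tangle cl p -> in_tangle cl q -> p != q -> phi p != phi q.
Proof. by move=> pP qP; apply: contraNneq => /rename_inj ->. Qed.

Lemma tangle_link L M : link L =1 link M -> V L = V M.
Proof. by move=> e; apply: skein_link => a; rewrite !link_cat (link_map phi e). Qed.

Lemma rename_notin p L :
  half_edge_of cl p -> {in points L, forall q, in_tangle cl q} ->
  p \notin points L -> phi p \notin points (map (map_arc phi) L ++ R).
Proof.
move=> pP LP pL; rewrite points_cat mem_cat negb_or points_map_arc; apply/andP; split.
  apply/mapP => -[q qL e]; case/negP: pL.
  by rewrite (rename_inj _ (LP q qL) e) //; apply: in_tangle_half_edge.
apply/negP => /R_out; case: p pP pL => [[[[c o]|]|] x] //= cP _.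
by rewrite map_f.
Qed.

(** The context, made of the arcs [R] and of the other crossings [cs], avoids the half-edges at the
    crossings of the tangle. The arcs at [p] in the tangle alone are therefore all the arcs at [p],
    and the local reduction is a reduction of the whole system. *)
Lemma eliminate_sound p L :
  half_edge_of cl p -> {in points L, forall q, in_tangle cl q} ->
  V L = delta ^+ (eliminate p L).1 * V (eliminate p L).2 /\
  {in points (eliminate p L).2, forall q, in_tangle cl q}.
Proof.
move=> pP LP; have idL : V L = delta ^+ false * V L by rewrite mul1r.
have ptP := in_tangle_half_edge pP.
have [p0 p1] : phi p != start /\ phi p != finish.
  by move: pP; case: (p) => [[[[]|]|]].
have pcs : ~~ half_edge_of cs (phi p).
  move: pP; case: (p) => [[[[c o]|]|]] //= x cP.
  by apply/negP => /cs_out; rewrite map_f.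
rewrite /eliminate; case E: (take_at p L) => [[[y n] L1]|]; last by split.
have L1e := take_atP E; have pt1 := link_points L1e.
have ptL1 : {in points L1, forall q, in_tangle cl q}.
  by move=> q qL; apply: LP; rewrite pt1 points_cons !inE qL !orbT.
have yP : in_tangle cl y by apply: LP; rewrite pt1 points_cons !inE eqxx orbT.
case: ifP => [/eqP yp | yp].
  case: ifP => [pL1|_]; last by split.
  split; last exact: ptL1.
  rewrite (tangle_link L1e) yp [delta ^+ _]expr1.
  exact: (skein_loop n (rename_notin pP ptL1 pL1) p0 p1 pcs).
case E2 : (take_at p L1) => [[[z m] L2]|]; last by split.
case: ifP => [/andP [pL2 zp]|_]; last by split.
have L2e := take_atP E2; have pt2 := link_points L2e.
have zP : in_tangle cl z by apply: ptL1; rewrite pt2 points_cons !inE eqxx orbT.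
have ptL2 : {in points L2, forall q, in_tangle cl q}.
  by move=> q qL; apply: ptL1; rewrite pt2 points_cons !inE qL !orbT.
split; last first.
  by move=> q; rewrite points_cons !inE /= => /or3P [/eqP->|/eqP->|/ptL2].
have -> : V L = V [:: (y, p, - n), (p, z, m) & L2].
  apply: tangle_link => a; rewrite L1e link_cons L2e [RHS]link_cons; congr (_ || _).
  by rewrite (_ : (y, p, - n) = flip (p, y, n)) // link_flip1.
rewrite [delta ^+ _]expr0 mul1r.
apply: (skein_contract (- n) m (rename_notin pP ptL2 pL2) _ _ p0 p1 pcs).
- by apply: rename_neq; rewrite // eq_sym yp.
- by apply: rename_neq; rewrite // eq_sym.
Qed.

Lemma eliminates_sound ps L :
  {in ps, forall p, half_edge_of cl p} -> {in points L, forall q, in_tangle cl q} ->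
  V L = delta ^+ (eliminates ps L).1 * V (eliminates ps L).2.
Proof.
elim: ps L => [|p ps IH] L psP LP; first by rewrite mul1r.
have pP : half_edge_of cl p by apply: psP; rewrite inE eqxx.
have [E1 MP] := eliminate_sound pP LP.
have psP' : {in ps, forall q, half_edge_of cl q}.
  by move=> q qP; apply: psP; rewrite inE qP orbT.
have E2 := IH _ psP' MP.
have := scale_trans E1 E2.
rewrite [eliminates (p :: ps) L]/=; case: (eliminate p L) => b M.
by case: (eliminates ps _) => k M'.
Qed.

Lemma canonical_sound L : V (canonical L) = V L.
Proof.
apply: tangle_link => a.
rewrite /canonical (link_perm (permEl (perm_sort _ _))).
elim: L => //= b L IH; rewrite link_cons IH [RHS]link_cons; congr (_ || _).
by rewrite /orient; case: ifP => // _; rewrite link_flip1.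
Qed.

End Tangle.

Lemma scale_monomial (K : comUnitRingType) (A w : K) (n m e f : int) :
  A \is a GRing.unit ->
  (n * m)%:~R * A ^ (f + e) * w = n%:~R * A ^ e * (m%:~R * A ^ f * w).
Proof. by move=> uA; rewrite intrM exprzDr //; ring. Qed.

Lemma oppr_monomial (K : comUnitRingType) (A w : K) (m e f : int) :
  A \is a GRing.unit ->
  (- m)%:~R * A ^ (f + e) * w = - A ^ e * (m%:~R * A ^ f * w).
Proof. by move=> uA; rewrite mulrNz exprzDr //; ring. Qed.

Lemma term_value_opp W e (t : term) :
  term_value W (- t.1.1, t.1.2 + e, t.2) = - varA ^ e * term_value W t.
Proof. exact: oppr_monomial varA_unit. Qed.

Lemma term_value_scale W n e (t : term) :
  term_value W (n * t.1.1, t.1.2 + e, t.2) = n%:~R * varA ^ e * term_value W t.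
Proof. exact: scale_monomial varA_unit. Qed.

Lemma times_delta_sound W k ts :
  \sum_(t <- times_delta k ts) term_value W t
  = delta ^+ k * \sum_(t <- ts) term_value W t.
Proof.
elim: k ts => [|k IH] ts; first by rewrite mul1r.
rewrite [times_delta _ _]/= IH; set x := \sum_(t <- _ ++ _) _.
suff -> : x = delta * \sum_(t <- ts) term_value W t by rewrite exprSr mulrA.
have sum e : \sum_(t <- [seq (- t.1.1, t.1.2 + e, t.2) | t <- ts]) term_value W t
             = - varA ^ e * \sum_(t <- ts) term_value W t.
  rewrite big_map mulr_sumr; apply: eq_bigr => t _; exact: term_value_opp.
rewrite /x big_cat; transitivity (- varA ^ 2 * (\sum_(t <- ts) term_value W t)
    + - varA ^ (- 2) * (\sum_(t <- ts) term_value W t)); last by rewrite -mulrDl.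
congr (_ + _); exact: sum.
Qed.

Lemma mulr_suml2 (K : nzRingType) (I : Type) (ts : seq I) (Q : pred I) (F : I ->
  K) x y :
  (\sum_(t <- ts | Q t) F t) * x * y = \sum_(t <- ts | Q t) F t * x * y.
Proof. by rewrite !mulr_suml. Qed.

Lemma coefficient_sound W (X : seq (int * seq (arc point))) ts :
  uniq X -> {in ts, forall t : term, (t.1.2, t.2) \in X} ->
  \sum_(t <- ts) term_value W t =
  \sum_(x <- X) (coefficient ts x)%:~R * varA ^ x.1 * W x.2.
Proof.
move=> uX tsX.
have co x : (coefficient ts x)%:~R = \sum_(t <- ts | (t.1.2,
  t.2) == x) t.1.1%:~R :> laurent.
  elim: (ts) => [|t us IH]; first by rewrite big_nil.
  by rewrite big_cons -IH /=; case: ifP => // _; rewrite intrD.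
rewrite [RHS](eq_bigr (fun x => \sum_(t <- ts | (t.1.2, t.2) == x) term_value W t)).
  rewrite (exchange_big_dep predT) //= big_seq [RHS]big_seq.
  apply: eq_bigr => t tts.
  rewrite big_mkcond (bigD1_seq _ (tsX t tts) uX) /= eqxx big1 ?addr0 // => x.
  by rewrite eq_sym => /negPf ->.
by move=> x _; rewrite co; apply: etrans (mulr_suml2 _ _ _ _ _) _;
  apply: eq_bigr => t /eqP <-.
Qed.

Lemma same_terms_sound W ts us :
  same_terms ts us -> \sum_(t <- ts) term_value W t = \sum_(t <- us) term_value W t.
Proof.
move=> /allP tsus; pose X := undup [seq (t.1.2, t.2) | t <- ts ++ us].
have inX : {in ts ++ us, forall t : term, (t.1.2, t.2) \in X}.
  by move=> t tt; rewrite mem_undup (map_f (fun t : term => (t.1.2, t.2))).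
have uX : uniq X by apply: undup_uniq.
have -> := @coefficient_sound W X ts uX; last first.
  by move=> t tt; apply: inX; rewrite mem_cat tt.
have -> := @coefficient_sound W X us uX; last first.
  by move=> t tt; apply: inX; rewrite mem_cat tt orbT.
apply: eq_big_seq => x; rewrite mem_undup => /mapP [t tt ->].
have e : coefficient ts (t.1.2, t.2) = coefficient us (t.1.2, t.2) := eqP (tsus t tt).
by rewrite e.
Qed.

Lemma points_smooth_in_tangle cl b c :
  c \in cl -> {in points (smooth_arcs b c), forall p, in_tangle cl p}.
Proof.
move=> cP p /smooth_points; case: p => [[[[d o]|]|]] //= x.
by rewrite inE => /eqP ->.
Qed.

Lemma smooth_arcs_rename r b c :
  (r c).2 = c.2 -> smooth_arcs b (r c) = map (map_arc (rename r)) (smooth_arcs b c).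
Proof. by move=> e; rewrite /smooth_arcs /smooth_arc /map_arc /height /= e. Qed.

Lemma half_edges_tangle cs : {in half_edges cs, forall p, half_edge_of cs p}.
Proof.
move=> p /mapP [[c o] /allpairsP [[c' o'] [/= cP _ [-> ->]]] ->].
exact: cP.
Qed.

Lemma sum_term_value_shift W e ts :
  \sum_(t <- [seq (t.1.1, t.1.2 + e, t.2) | t <- ts]) term_value W t
  = varA ^ e * \sum_(t <- ts) term_value W t.
Proof.
rewrite big_map mulr_sumr; apply: eq_bigr => t _.
by have := term_value_scale W 1 e t; rewrite mul1r => ->; rewrite mul1r.
Qed.

Lemma sum_scale_terms W n e ts :
  \sum_(t <- scale_terms n e ts) term_value W t
  = n%:~R * varA ^ e * \sum_(t <- ts) term_value W t.
Proof. by rewrite big_map mulr_sumr; apply: eq_bigr => t _;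
  exact: term_value_scale. Qed.

(** [r] sends model crossings to those of an actual code. As [skein] smooths the head of its list
    first, the tangle is expanded while the crossings of [cs] stay inside the value of each term. *)
Lemma expansion_sound r cl cs R ps cl' L :
  {in cl &, injective r} -> {in cl, forall c, (r c).2 = c.2} ->
  {in points R, forall p, ~~ half_edge_of (map r cl) p} ->
  {in cs, forall c, c \notin map r cl} ->
  {in ps, forall p, half_edge_of cl p} -> {subset cl' <= cl} ->
  {in points L, forall p, in_tangle cl p} ->
  skein (map r cl' ++ cs) (map (map_arc (rename r)) L ++ R) =
  \sum_(t <- expansion ps cl' L)
    term_value (fun M => skein cs (map (map_arc (rename r)) M ++ R)) t.
Proof.
move=> r_inj r_sign R_out cs_out ps_cl.
elim: cl' L => [|c cl' IH] L cl'cl LP.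
  have := eliminates_sound r_inj R_out cs_out ps_cl LP.
  rewrite [expansion _ _ _]/=; case: (eliminates ps L) => k M e.
  rewrite times_delta_sound big_seq1.
  rewrite /term_value [X in _ = _ * X](_ : _ = skein cs (map (map_arc (rename r)) M
    ++ R)).
    exact: e.
  rewrite -(canonical_sound r cs R M).
  by rewrite [_ * varA ^ _](_ : _ = 1) ?mul1r // mul1r expr0z.
have ccl : c \in cl by apply: cl'cl; rewrite inE eqxx.
have subcl : {subset cl' <= cl} by move=> d dc; apply: cl'cl; rewrite inE dc orbT.
have LP' b : {in points (smooth_arcs b c ++ L), forall p, in_tangle cl p}.
  by move=> p; rewrite points_cat mem_cat =>
    /orP [/(points_smooth_in_tangle ccl)|/LP].
have E b : smooth_arcs b (r c) ++ map (map_arc (rename r)) L ++ R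
    = map (map_arc (rename r)) (smooth_arcs b c ++ L) ++ R.
  by rewrite smooth_arcs_rename ?r_sign // map_cat catA.
have -> : expansion ps (c :: cl') L =
    [seq (t.1.1, t.1.2 + 1, t.2) | t <- expansion ps cl' (smooth_arcs true c ++ L)] ++
    [seq (t.1.1, t.1.2 - 1, t.2) | t <- expansion ps cl' (smooth_arcs false c ++
      L)] by [].
rewrite [RHS]big_cat (sum_term_value_shift _ 1) (sum_term_value_shift _ (- 1)).
rewrite -(IH _ subcl (LP' true)) -(IH _ subcl (LP' false)) -!E.
exact: skein_cons.
Qed.

(** * Cutting a tangle out of a code *)

Lemma strand_cat a w1 w2 b :
  exists (T T' : seq (arc point)) (x y : point), strand a (w1 ++ w2) b = T ++ (x,
    y, 0) :: T' /\
    forall q, strand a w1 q = T ++ [:: (x, q, 0)] /\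
              strand q w2 b = (q, y, 0) :: T'.
Proof.
elim: w1 a => [|x w1 IH] a /=.
  case: w2 => [|y w2] /=; first by exists [::], [::], a, b.
  by exists [::], (strand (Some y, false) w2 b), a, (Some y, true).
have [T [T' [x' [y [E F]]]]] := IH (Some x, false).
exists ((a, (Some x, true), 0) :: T), T', x', y; split; first by rewrite E.
by move=> q; have [-> ->] := F q.
Qed.

Lemma strand_points a w b p :
  p \in points (strand a w b) ->
  [\/ p = a, p = b | exists2 x, x \in w & p.1 = Some x].
Proof.
elim: w a => [|x w IH] a /=.
  by rewrite /points /= !inE => /orP [] /eqP ->; [constructor 1 | constructor 2].
rewrite points_cons !inE /= => /or3P [/eqP->|/eqP->|/IH [->|->|[y yw py]]].
- by constructor 1.
- by constructor 3; exists x; rewrite ?inE ?eqxx.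
- by constructor 3; exists x; rewrite ?inE ?eqxx.
- by constructor 2.
- by constructor 3; exists y; rewrite ?inE ?yw ?orbT.
Qed.

(** Exactly one arc, of weight 0, leads from [w1] to [w2]; cutting it at a fresh point is a
    contraction read backwards. *)
Lemma skein_strand_split cs a w1 w2 b q R :
  q \notin points (strand a (w1 ++ w2) b) -> q \notin points R ->
  q != start -> q != finish -> ~~ half_edge_of cs q ->
  skein cs (strand a (w1 ++ w2) b ++ R) = skein cs (strand a w1 q ++ strand q w2 b
    ++ R).
Proof.
have [T [T' [x [y [E F]]]]] := strand_cat a w1 w2 b; have [-> ->] := F q.
rewrite E points_cat points_cons mem_cat !inE !negb_or /=.
move=> /and4P [qT qx qy qT'] qR q0 q1 qcs.
have -> : skein cs ((T ++ [:: (x, q, 0)]) ++ ((q, y, 0) :: T') ++ R) =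
          skein cs [:: (x, q, 0), (q, y, 0) & T ++ T' ++ R].
  apply/skein_link/link_perm.
  by rewrite -catA; exact: (permEl (perm_catCA T [:: (x, q, 0);
    (q, y, 0)] (T' ++ R))).
rewrite skein_contract //; last by rewrite !points_cat !mem_cat !negb_or qT qT'.
rewrite addr0; apply/skein_link/link_perm.
by rewrite -catA; exact: (permEl (perm_catCA T [:: (x, y, 0)] (T' ++ R))).
Qed.

(* The code passing through the strands [ss] of a tangle, and through [K0] and
   [Ks] outside it. *)
Fixpoint weave (K0 : seq pass) (ss Ks : seq (seq pass)) : seq pass :=
  match ss, Ks with
  | s :: ss', K :: Ks' => K0 ++ s ++ weave K ss' Ks'
  | _, _ => K0
  end.

(** The outer strands end at even cut points and start at odd ones, whereas the strands of the
    tangle run from even to odd ones. *)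
Fixpoint complement (a : point) (K0 : seq pass) (i : nat) (Ks : seq (seq pass))
    (b : point) : seq (arc point) :=
  if Ks is K :: Ks' then
    strand a (map inl K0) (dummy (2 * i)) ++ complement (dummy (2 * i).+1) K i.+1
      Ks' b
  else strand a (map inl K0) b.

(** Excludes the cut points numbered [i] or more, which are still to be introduced. *)
Definition old (i : nat) (p : point) : bool :=
  if p is (Some (inr j), _) then (j < i)%N else true.

Lemma old_leq i j p : (i <= j)%N -> old i p -> old j p.
Proof. by case: p => [[[|k]|]] //= _ ij ki; apply: leq_trans ij. Qed.

Lemma strand_old i a (w : seq pass) b :
  old i a -> old i b -> {in points (strand a (map inl w) b), forall p, old i p}.
Proof.
move=> ai bi p /strand_points [->|->|[x /mapP [q _ ->]]] //.
by case: p => [[[|]|]].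
Qed.

Lemma skein_weave cs i K0 ss Ks a b R :
  size ss = size Ks -> old (2 * i) a -> old (2 * i) b ->
  {in points R, forall p, old (2 * i) p} ->
  skein cs (strand a (map inl (weave K0 ss Ks)) b ++ R) =
  skein cs (strands_from i ss ++ complement a K0 i Ks b ++ R).
Proof.
elim: ss Ks i K0 a R => [|s ss IH] [|K Ks] //= i K0 a R [sz] ai bi Ri.
have notold j p : old j p -> (p == dummy j) = false.
  by case: p => [[[|k]|]] //= x kj; apply/negP => /eqP [ke _]; rewrite ke ltnn in kj.
have bi' : old (2 * i).+1 b by apply: old_leq bi.
rewrite !map_cat (@skein_strand_split _ _ _ _ _ (dummy (2 * i))) //; last 2 first.
- rewrite -!map_cat; apply/negP => /(strand_old ai bi).
  by rewrite /= ltnn.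
- by apply/negP => /Ri; rewrite /= ltnn.
set T := strand a _ _.
rewrite (@skein_link _ _ (strand (dummy (2 * i)) (map inl s ++ map inl (weave K ss
  Ks)) b
   ++ T ++ R)); last by apply: link_perm; rewrite perm_catCA.
have Ti : {in points T, forall p, old (2 * i).+1 p}.
  by apply: strand_old => //=; apply: old_leq ai.
have TRi : {in points (T ++ R), forall p, old (2 * i).+1 p}.
  move=> p; rewrite points_cat mem_cat => /orP [/Ti //|/Ri].
  exact: old_leq.
rewrite (@skein_strand_split _ _ _ _ _ (dummy (2 * i).+1)) //; last 2 first.
- rewrite -map_cat; apply/negP.
  move/(@strand_old (2 * i).+1 (dummy (2 * i)) _ b (ltnSn _) bi').
  by rewrite /= ltnn.
- by apply/negP => /TRi; rewrite /= ltnn.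
set S := strand _ _ (dummy (2 * i).+1).
have e2 : (2 * i.+1 = (2 * i).+2)%N by rewrite mulnS.
have Si : {in points S, forall p, old (2 * i).+2 p} by apply: strand_old => //=.
rewrite (@skein_link _ _ (strand (dummy (2 * i).+1) (map inl (weave K ss Ks)) b
   ++ S ++ T ++ R)); last by apply: link_perm; rewrite perm_catCA.
rewrite (IH _ i.+1) //; last first.
- move=> p; rewrite e2 points_cat mem_cat => /orP [/Si //|/TRi].
  exact: old_leq.
- by rewrite e2; apply: old_leq bi; rewrite leqW.
- by rewrite e2 /=.
apply/skein_link/link_perm/permP => f; rewrite !count_cat.
lia.
Qed.

Definition in_crossings (cl : seq crossing) (K : seq pass) := all (fun p : pass =>
  p.1 \in cl) K.
Definition off_crossings (cl : seq crossing) (K : seq pass) := all (fun p : pass =>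
  p.1 \notin cl) K.

Definition rename_pass (r : crossing -> crossing) (p : pass) : pass := (r p.1, p.2).

Lemma map_arc_strand r a w b :
  map (map_arc (rename r)) (strand a (map inl w) b) =
  strand (rename r a) (map inl (map (rename_pass r) w)) (rename r b).
Proof. by elim: w a => [|[c o] w IH] a //=; rewrite IH. Qed.

Lemma map_arc_strands_from r i ss :
  map (map_arc (rename r)) (strands_from i ss) = strands_from i (map (map
    (rename_pass r)) ss).
Proof. by elim: ss i => [|s ss IH] i //=; rewrite map_cat map_arc_strand IH. Qed.

Lemma strands_from_in_tangle cl i ss :
  all (in_crossings cl) ss -> {in points (strands_from i ss), forall p,
    in_tangle cl p}.
Proof.
elim: ss i => [|s ss IH] i //= /andP [/allP sP ssP] p; rewrite points_cat mem_cat.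
case/orP => [/strand_points [->|->|[x /mapP [[c o] /sP cP ->]]] //|/(IH _ ssP) //].
by case: p => y z /= ->.
Qed.

Lemma complement_off cl a K0 i Ks b :
  ~~ half_edge_of cl a -> ~~ half_edge_of cl b ->
  off_crossings cl K0 -> all (off_crossings cl) Ks ->
  {in points (complement a K0 i Ks b), forall p, ~~ half_edge_of cl p}.
Proof.
have off x y K : ~~ half_edge_of cl x -> ~~ half_edge_of cl y -> off_crossings cl K ->
    {in points (strand x (map inl K) y), forall p, ~~ half_edge_of cl p}.
  move=> xP yP /allP KP p /strand_points [->|->|[z /mapP [[c o] /KP cP ->]]] //.
  by case: p => u v /= ->.
elim: Ks a K0 i => [|K Ks IH] a K0 i aP bP K0P /=; first by move=> _; apply: off.
case/andP => KP KsP p; rewrite points_cat mem_cat => /orP [|]; first exact: off.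
exact: IH.
Qed.

Lemma skein_tangle r cl cl' cs ss K0 Ks :
  {in cl &, injective r} -> {in cl, forall c, (r c).2 = c.2} ->
  {subset cl' <= cl} -> {in cs, forall c, c \notin map r cl} ->
  all (in_crossings cl') ss -> off_crossings (map r cl) K0 ->
  all (off_crossings (map r cl)) Ks -> size ss = size Ks ->
  skein (map r cl' ++ cs)
    (strand start (map inl (weave K0 (map (map (rename_pass r)) ss) Ks)) finish) =
  \sum_(t <- tangle_terms cl' ss)
    term_value (fun M => skein cs (map (map_arc (rename r)) M
                  ++ complement start K0 0 Ks finish)) t.
Proof.
move=> r_inj r_sign subcl cs_out ssP K0P KsP sz.
rewrite -(cats0 (strand _ _ _)) (@skein_weave _ 0) ?size_map // cats0.
rewrite -map_arc_strands_from; apply: (expansion_sound (cl := cl)) => //.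
- exact: complement_off.
- move=> p /half_edges_tangle; case: p => [[[[c o]|]|] x] //=; exact: subcl.
- move=> p /(strands_from_in_tangle ssP); case: p => [[[[c o]|]|] x] //=;
  exact: subcl.
Qed.

(** Both sides of a move share the renaming [r] and the context, [cl] being the crossings of the
    larger side; the identity then only concerns the local expansions. *)
Lemma skein_tangle_move r cl cl' cs ss ss' K0 Ks n e :
  {in cl &, injective r} -> {in cl, forall c, (r c).2 = c.2} ->
  {subset cl' <= cl} -> {in cs, forall c, c \notin map r cl} ->
  all (in_crossings cl) ss -> all (in_crossings cl') ss' ->
  off_crossings (map r cl) K0 -> all (off_crossings (map r cl)) Ks ->
  size ss = size Ks -> size ss' = size Ks ->
  same_terms (tangle_terms cl ss) (scale_terms n e (tangle_terms cl' ss')) ->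
  skein (map r cl ++ cs)
    (strand start (map inl (weave K0 (map (map (rename_pass r)) ss) Ks)) finish) =
  n%:~R * varA ^ e * skein (map r cl' ++ cs)
    (strand start (map inl (weave K0 (map (map (rename_pass r)) ss') Ks)) finish).
Proof.
move=> r_inj r_sign subcl cs_out ssP ssP' K0P KsP sz sz' st.
rewrite (@skein_tangle r cl cl) // (@skein_tangle r cl cl') //.
rewrite -sum_scale_terms; exact: same_terms_sound.
Qed.

(** * Reidemeister moves *)

(** The normalized state sum of a bare code: its powers of u come from the turning weights and not
    from a shortcut. *)
Definition code_value (K : seq pass) : laurent :=
  (- varA) ^ (- 3 * writhe K) * skein (crossings K) (strand start (map inl K) finish).

Lemma crossings_cat K1 K2 : crossings (K1 ++ K2) = crossings K1 ++ crossings K2.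
Proof. by rewrite /crossings filter_cat map_cat. Qed.

Lemma perm_crossings K1 K2 : perm_eq K1 K2 -> perm_eq (crossings K1) (crossings K2).
Proof. by move=> e; apply: perm_map; apply: perm_filter. Qed.

Lemma crossings_rename r K : crossings (map (rename_pass r) K) = map r (crossings K).
Proof. by elim: K => //= -[c []] K /= <-. Qed.

Lemma mem_crossings K c : (c \in crossings K) = ((c, true) \in K).
Proof.
apply/mapP/idP => [[[d o]]|cK]; last by exists (c, true) => //; rewrite mem_filter.
by rewrite mem_filter /= => /andP [-> dK] ->.
Qed.

Lemma perm_weave K0 ss Ks :
  size ss = size Ks -> perm_eq (weave K0 ss Ks) (flatten ss ++ K0 ++ flatten Ks).
Proof.
elim: ss K0 Ks => [|s ss IH] K0 [|K Ks] //= => [_|[/(IH K) h]];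
  first by rewrite cats0.
by apply/permP => f; have := permP h f; rewrite !count_cat; lia.
Qed.

(** Asking that both passes through each crossing of [cl] lie in the tangle keeps these crossings
    out of the rest of a duplicate-free code. *)
Definition tangle_code (cl : seq crossing) (ss : seq (seq pass)) : bool :=
  [&& perm_eq (crossings (flatten ss)) cl, all (in_crossings cl) ss &
      all (fun c => ((c, true) \in flatten ss) && ((c, false) \in flatten ss)) cl].

Lemma map_rename_flatten r ss :
  flatten (map (map (rename_pass r)) ss) = map (rename_pass r) (flatten ss).
Proof. by rewrite map_flatten. Qed.

Lemma code_tangle_move r cl cl' ss ss' K0 Ks n e :
  {in cl &, injective r} -> {in cl, forall c, (r c).2 = c.2} ->
  {subset cl' <= cl} -> tangle_code cl ss -> tangle_code cl' ss' ->
  size ss = size Ks -> size ss' = size Ks ->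
  same_terms (tangle_terms cl ss) (scale_terms n e (tangle_terms cl' ss')) ->
  let K := weave K0 (map (map (rename_pass r)) ss) Ks in
  let L := weave K0 (map (map (rename_pass r)) ss') Ks in
  uniq K ->
  skein (crossings K) (strand start (map inl K) finish) =
  n%:~R * varA ^ e * skein (crossings L) (strand start (map inl L) finish)
  /\ writhe K - \sum_(c <- cl) sign c.2 = writhe L - \sum_(c <- cl') sign c.2.
Proof.
move=> r_inj r_sign subcl /and3P [pcl incl bcl] /and3P [pcl' incl' _] sz sz' st K L
  uK.
pose cs := crossings (K0 ++ flatten Ks).
have perm cm tt : perm_eq (crossings (flatten tt)) cm -> size tt = size Ks ->
    perm_eq (crossings (weave K0 (map (map (rename_pass r)) tt) Ks)) (map r cm ++ cs).
  move=> ptt stt; apply: perm_trans (perm_crossings (perm_weave _ _)) _.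
    by rewrite size_map.
  rewrite crossings_cat perm_cat2r map_rename_flatten crossings_rename.
  exact: perm_map.
have pK := perm _ _ pcl sz; have pL := perm _ _ pcl' sz'.
have out : {in K0 ++ flatten Ks, forall p, p.1 \notin map r cl}.
  move: uK; rewrite /K (perm_uniq (perm_weave _ _)) ?size_map // cat_uniq.
  case/and3P => _ /hasPn h _ [c o] /h cK; apply/negP => /mapP [d dcl /= e'].
  case/negP: cK; rewrite map_rename_flatten e' (_ : (r d, o) = rename_pass r (d,
    o)) //.
  by apply: map_f; have /andP [] := allP bcl d dcl; case: (o).
have writhe_sum cm M : {subset cm <= cl} -> perm_eq (crossings M) (map r cm ++ cs) ->
    writhe M - \sum_(c <- cm) sign c.2 = \sum_(c <- cs) sign c.2.
  move=> sub pM; rewrite /writhe (perm_big _ pM) big_cat big_map /=.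
  rewrite (eq_big_seq (fun c => sign c.2)); last by move=> c /sub /r_sign ->.
  by rewrite addrAC subrr add0r.
split; last by rewrite (writhe_sum _ _ _ pK) // (writhe_sum _ _ _ pL).
rewrite (skein_perm _ pK) (skein_perm _ pL).
apply: skein_tangle_move st => //.
- by move=> c; rewrite mem_crossings => /out.
- by apply/allP => p pK0; apply: out; rewrite mem_cat pK0.
- apply/allP => M MK; apply/allP => p pM; apply: out; rewrite mem_cat.
  by apply/orP; right; apply/flattenP; exists M.
Qed.

Lemma kink_scale (R : comUnitRingType) (A x : R) (b : bool) (w : int) :
  A \is a GRing.unit ->
  (- A) ^ (- 3 * (sign b + w)) * ((-1)%:~R * A ^ (3 * sign b) * x) = (- A) ^ (- 3 *
    w) * x.
Proof.
move=> uA; have uN : - A \is a GRing.unit by rewrite unitrN.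
rewrite mulrDr exprzDr //.
suff e : (- A) ^ (- 3 * sign b) * ((-1)%:~R * A ^ (3 * sign b)) = 1.
  by rewrite mulrACA e mul1r.
(* A positive and a negative kink are this identity for [A] and for its inverse. *)
have cube (B : R) : B \is a GRing.unit -> (- B) ^ (- 3) * ((-1)%:~R * B ^ 3) = 1.
  move=> uB; have -> : (-1)%:~R * B ^ 3 = (- B) ^ 3 by rewrite mulrN1z; ring.
  by rewrite -exprzDr ?unitrN.
case: b => /=; rewrite ?mulr1; first exact: cube.
have -> : 3 * -1 = - 3 :> int by [].
have -> : - 3 * -1 = 3 :> int by [].
have := cube A^-1; rewrite unitrV => /(_ uA).
by rewrite !exprz_inv -invrN exprz_inv opprK.
Qed.

Lemma RI_value (c : crossing) (o : bool) K1 K2 :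
  uniq (K1 ++ [:: (c, o); (c, ~~ o)] ++ K2) ->
  code_value (K1 ++ [:: (c, o); (c, ~~ o)] ++ K2) = code_value (K1 ++ K2).
Proof.
move=> uL; set L := K1 ++ _ ++ _ in uL *.
pose c0 : crossing := (0%N, c.2).
have tc p : tangle_code [:: (0%N, p)] [:: [:: ((0%N, p), o); ((0%N, p), ~~ o)]].
  by case: p; case: (o).
have [||||||||e ew] := @code_tangle_move (fun _ => c) [:: c0] [::]
    [:: [:: (c0, o); (c0, ~~ o)]] [:: [::]] K1 [:: K2] (-1) (3 * sign c.2) _ _ _ _
      _ _ _ _ uL.
- by move=> x y; rewrite !inE => /eqP -> /eqP ->.
- by move=> x; rewrite !inE => /eqP ->.
- by [].
- exact: tc.
- by [].
- by [].
- by [].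
- exact: RI_terms.
have ew' : writhe L = sign c.2 + writhe (K1 ++ K2).
  by move: ew; rewrite big_seq1 big_nil subr0 => <-; rewrite addrC subrK.
rewrite /code_value ew'.
apply: etrans (congr1 _ e) _.
exact: kink_scale varA_unit.
Qed.

Lemma scale_one (R : comUnitRingType) (A x : R) : 1%:~R * A ^ (0 : int) * x = x.
Proof. by rewrite expr0z !mul1r. Qed.

Lemma RII_value (c d : crossing) (o : bool) s K1 K2 K3 :
  c.2 != d.2 ->
  s = [:: (c, ~~ o); (d, ~~ o)] \/ s = [:: (d, ~~ o); (c, ~~ o)] ->
  uniq (K1 ++ [:: (c, o); (d, o)] ++ K2 ++ s ++ K3) ->
  code_value (K1 ++ [:: (c, o); (d,
    o)] ++ K2 ++ s ++ K3) = code_value (K1 ++ K2 ++ K3).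
Proof.
move=> cd sE uL.
have d2 : d.2 = ~~ c.2 by move: cd; case: (c.2); case: (d.2).
pose c0 : crossing := (0%N, c.2); pose d0 : crossing := (1%N, ~~ c.2).
pose r (x : crossing) := if x.1 == 0%N then c else d.
have [q sq] : exists q : bool, s = map (rename_pass r)
    (if q then [:: (c0, ~~ o); (d0, ~~ o)] else [:: (d0, ~~ o); (c0, ~~ o)]).
  by case: sE => ->; [exists true | exists false].
rewrite {}sq {s sE} in uL *; set s := (if q then _ else _) in uL *.
have tc : tangle_code [:: c0; d0] [:: [:: (c0, o); (d0, o)]; s].
  by rewrite /s /c0 /d0; case: (c.2); case: (o); case: (q).
have [||||||||e ew] := @code_tangle_move r [:: c0; d0] [::]
    [:: [:: (c0, o); (d0, o)]; s] [:: [::]; [::]] K1 [:: K2;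
      K3] 1 0 _ _ _ _ _ _ _ _ uL.
- by move=> x y; rewrite !inE => /orP [] /eqP -> /orP [] /eqP -> //= dc;
    move: cd; rewrite /r /= in dc; rewrite dc eqxx.
- by move=> x; rewrite !inE => /orP [] /eqP ->.
- by [].
- exact: tc.
- by [].
- by [].
- by [].
- exact: RII_terms.
have ew' : writhe (K1 ++ [:: (c, o); (d, o)] ++ K2 ++ map (rename_pass r) s ++ K3)
         = writhe (K1 ++ K2 ++ K3).
  have s0 : \sum_(x <- [:: c0; d0]) sign x.2 = 0.
    by rewrite !big_cons big_nil /=; case: (c.2).
  by move: ew; rewrite s0 big_nil !subr0.
rewrite /code_value ew'.
by apply: congr1; apply: etrans e (scale_one _ _).
Qed.

Lemma perm_mapP (T U : eqType) (f : T -> U) (s : seq U) (t : seq T) :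
  perm_eq s (map f t) -> exists2 t', perm_eq t' t & s = map f t'.
Proof.
case: t => [|x t] p; first by exists [::] => //; apply/nilP;
  rewrite /nilp (perm_size p).
have [Is pIs ->] := perm_iotaP (f x) p.
exists (map (nth x (x :: t)) Is).
  by apply/(perm_iotaP x); exists Is; rewrite // -(size_map f).
rewrite -map_comp; apply/eq_in_map => i;
  rewrite (perm_mem pIs) mem_iota add0n => /andP [_].
by rewrite size_map => li; rewrite (nth_map x).
Qed.

Lemma RIII_value (x y z : crossing) (t m b : bool) s1 s2 s3 K1 K2 K3 K4 :
  x.2 (+) b = y.2 (+) m -> y.2 (+) m = z.2 (+) t ->
  perm_eq [:: s1; s2; s3] (triangle x y z t m b) ->
  uniq (K1 ++ s1 ++ K2 ++ s2 ++ K3 ++ s3 ++ K4) ->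
  code_value (K1 ++ s1 ++ K2 ++ s2 ++ K3 ++ s3 ++ K4) =
  code_value (K1 ++ rev s1 ++ K2 ++ rev s2 ++ K3 ++ rev s3 ++ K4).
Proof.
move=> e1 e2 ps uK.
pose x0 : crossing := (0%N, x.2); pose y0 : crossing := (1%N, y.2).
pose z0 : crossing := (2%N, z.2).
pose r (c : crossing) := nth x [:: x; y; z] c.1.
(* The strands, in the order in which the code meets them, are a permutation of a renamed model
   triangle, hence the renaming of a permutation of the model. *)
have tE : triangle x y z t m b = map (map (rename_pass r)) (triangle x0 y0 z0 t m b).
  by case: (t); case: (m); case: (b).
have pt := ps; rewrite tE in ps; have [ss pss sE] := perm_mapP ps.
have tc (uu : seq (seq pass)) : perm_eq uu (triangle x0 y0 z0 t m b) ->
    tangle_code [:: x0; y0; z0] uu && tangle_code [:: x0; y0; z0] (map rev uu).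
  rewrite -mem_permutations => uuP.
  suff : all (fun uu => tangle_code [:: x0; y0; z0] uu && tangle_code [:: x0; y0;
    z0] (map rev uu))
      (permutations (triangle x0 y0 z0 t m b)) by move/allP; apply.
  by rewrite /x0 /y0 /z0; case: (x.2); case: (y.2); case: (z.2); case: (t);
    case: (m); case: (b); vm_compute.
have /andP [tc1 tc2] := tc _ pss.
have szs : size ss = 3 by rewrite -(size_map (map (rename_pass r))) -sE.
have KE : K1 ++ s1 ++ K2 ++ s2 ++ K3 ++ s3 ++ K4 =
          weave K1 (map (map (rename_pass r)) ss) [:: K2; K3; K4] by rewrite -sE.
have LE : K1 ++ rev s1 ++ K2 ++ rev s2 ++ K3 ++ rev s3 ++ K4 =
          weave K1 (map (map (rename_pass r)) (map rev ss)) [:: K2; K3; K4].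
  have -> : map (map (rename_pass r)) (map rev ss) = map rev (map (map (rename_pass
    r)) ss).
    by rewrite -!map_comp; apply: eq_map => s /=; rewrite map_rev.
  by rewrite -sE.
(* The code has no repeated pass, so the six passes of the triangle are distinct, and this forces
   [x], [y], [z] to be distinct. *)
have r_inj : {in [:: x0; y0; z0] &, injective r}.
  have : uniq (flatten (triangle x y z t m b)).
    rewrite -(perm_uniq (perm_flatten pt)).
    by move: uK; rewrite (perm_uniq (@perm_weave K1 [:: s1; s2; s3] [:: K2; K3;
      K4] erefl)) cat_uniq => /and3P [].
  have -> : uniq (flatten (triangle x y z t m b)) = [&& x != y, x != z & y != z].
    rewrite /triangle /directed; case: (t); case: (m); case: (b);
      rewrite /= !inE !xpair_eqE;
      rewrite ?(eq_sym y x) ?(eq_sym z x) ?(eq_sym z y);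
      case: (x == y); case: (x == z); case: (y == z); rewrite ?eqxx ?andbF ?orbF //.
  case/and3P => xy xz yz c d; rewrite !inE.
  by move=> /or3P [] /eqP -> /or3P [] /eqP -> //=; rewrite /r /= => cd;
    move: xy xz yz; rewrite cd eqxx.
rewrite KE LE in uK *.
have r_sign : {in [:: x0; y0; z0], forall c, (r c).2 = c.2}.
  by move=> c; rewrite !inE => /or3P [] /eqP ->.
have st : same_terms (tangle_terms [:: x0; y0; z0] ss)
    (scale_terms 1 0 (tangle_terms [:: x0; y0; z0] (map rev ss))).
  by apply: RIII_terms e1 e2 _; rewrite mem_permutations.
have szs' : size (map rev ss) = 3 by rewrite size_map.
have [e ew] := @code_tangle_move r [:: x0; y0; z0] [:: x0; y0; z0]
    ss (map rev ss) K1 [:: K2; K3; K4] 1 0 r_inj r_sign (fun _ h =>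
      h) tc1 tc2 szs szs' st uK.
move/addIr: ew => ew; rewrite /code_value ew.
by apply: congr1; apply: etrans e (scale_one _ _).
Qed.

Lemma evaluates_rename_iff r L k n :
  injective r ->
  evaluates start finish (map (map_arc (rename r)) L) k n <->
  evaluates start finish L k n.
Proof.
move=> r_inj.
have phi_inj : injective (rename r).
  move=> [[[[c o]|j]|] x] [[[[d o']|j']|] x'] //= [].
  by move=> /r_inj -> -> ->.
have ends M g f : evaluates_with start finish g f M k n ->
    start \in points M /\ finish \in points M by case=> _ _ [[]].
split=> [h|[g [f h]]].
  have [g [f /ends]] := h; rewrite !points_map_arc => -[sL fL].
  apply: (@evaluates_map _ _ (rename r) start finish) h => //.
  - by move=> p q _ _ /phi_inj.
  - by have := sL; rewrite -{1}[start]/(rename r start) mem_map.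
  - by have := fL; rewrite -{1}[finish]/(rename r finish) mem_map.
have [sL fL] := ends _ _ _ h.
(* [rename r] need not be surjective: a left inverse is chosen, and the converse is transported
   along it. *)
have [psi psiK] : exists psi, cancel (rename r) psi.
  have [q|psi psiP] := choice (P := fun q p : point =>
      (exists p', rename r p' = q) -> rename r p = q).
    by case: (pselect (exists p', rename r p' = q)) => [[p' <-]|np];
      [exists p' | exists q].
  by exists psi => p; apply: phi_inj; apply: psiP; exists p.
have e : map (map_arc psi) (map (map_arc (rename r)) L) = L.
  rewrite -map_comp -[RHS]map_id; apply: eq_map => -[[x y] w].
  by rewrite /map_arc /= !psiK.
have eL : evaluates (psi start) (psi finish)
    (map (map_arc psi) (map (map_arc (rename r)) L)) k n.
  rewrite e -[start]/(rename r start) -[finish]/(rename r finish) !psiK.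
  by exists g, f.
apply: evaluates_map eL; last 2 first.
- by rewrite points_map_arc -[start]/(rename r start) map_f.
- by rewrite points_map_arc -[finish]/(rename r finish) map_f.
move=> p q; rewrite points_map_arc => /mapP [p' _ ->] /mapP [q' _ ->].
by rewrite !psiK => ->.
Qed.

Lemma skein_rename r cs L :
  injective r -> (forall c, (r c).2 = c.2) ->
  skein (map r cs) (map (map_arc (rename r)) L) = skein cs L.
Proof.
move=> r_inj r_sign; elim: cs L => [|c cs IH] L.
  by apply: value_iff => k n; apply: evaluates_rename_iff.
rewrite (skein_cons c cs) -(IH (smooth_arcs true c ++ L)) -(IH (smooth_arcs false c
  ++ L)).
rewrite !map_cat -!(smooth_arcs_rename _ (r_sign c)); exact: skein_cons.
Qed.

Lemma relabel_value r K :
  injective r -> (forall c, (r c).2 = c.2) ->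
  code_value (map (rename_pass r) K) = code_value K.
Proof.
move=> r_inj r_sign; rewrite /code_value crossings_rename.
have -> : writhe (map (rename_pass r) K) = writhe K.
  by rewrite /writhe crossings_rename big_map; apply: eq_bigr => c _; rewrite r_sign.
by rewrite -(map_arc_strand r start K finish) skein_rename.
Qed.

Lemma move_value K L :
  uniq K -> uniq L -> diagram_move K L -> code_value K = code_value L.
Proof.
move=> uK uL m; case: m uK uL => [r M r_inj r_sign|c o K1 K2|c d o s K1 K2 K3 cd sE|
  x y z t m b s1 s2 s3 K1 K2 K3 K4 e1 e2 p] uK uL.
- by rewrite (relabel_value M r_inj r_sign).
- by rewrite RI_value.
- by rewrite (RII_value cd sE).
- exact: RIII_value e1 e2 p uK.
Qed.

Lemma equivalent_value K L : equivalent K L ->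
  code_value (code K) = code_value (code L).
Proof.
have uc (D : diagram) : uniq (code D) by have /andP [] := code_wf D.
elim=> [D E m|D|D E _ e|D E F _ e1 _ e2].
- exact (move_value (uc D) (uc E) m).
- exact (erefl _).
- exact (esym e).
- exact (etrans e1 e2).
Qed.

(** * Homology of the sphere *)

Section FunctionMatrix.

Variable D : finType.
Implicit Types (f g : D -> D) (v : D -> rat).

Local Notation n := #|D|.

(** Acts on the right on row vectors, read as functions on [D], by composition with [f]. *)
Definition pullback_mx f : 'M[rat]_n :=
  \matrix_(i, j) (enum_val i == f (enum_val j))%:R.

Definition row_of v : 'rV[rat]_n := \row_i v (enum_val i).

Lemma sum_delta (F : D -> rat) (d : D) :
  \sum_(i < n) F (enum_val i) * (enum_val i == d)%:R = F d.
Proof.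
rewrite (bigD1 (enum_rank d)) //= enum_rankK eqxx mulr1 big1 ?addr0 // => i ne.
rewrite (_ : enum_val i == d = false) ?mulr0 //.
by apply: contraNF ne => /eqP <-; rewrite enum_valK.
Qed.

Lemma row_of_pullback v f : row_of v *m pullback_mx f = row_of (v \o f).
Proof.
apply/rowP => j; rewrite !mxE.
under eq_bigr do rewrite !mxE.
exact: sum_delta.
Qed.

Lemma row_ofK (r : 'rV[rat]_n) : row_of (fun d => r 0 (enum_rank d)) = r.
Proof. by apply/rowP => i; rewrite !mxE enum_valK. Qed.

Lemma row_of_inj v v' : row_of v = row_of v' -> v =1 v'.
Proof. by move=> /rowP e d; have := e (enum_rank d); rewrite !mxE enum_rankK. Qed.

Lemma pullback_comp f g : pullback_mx f *m pullback_mx g = pullback_mx (f \o g).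
Proof.
apply/row_matrixP => i; rewrite row_mul.
have rowE h : row i (pullback_mx h) = row_of (fun d => (enum_val i == h d)%:R).
  by apply/rowP => j; rewrite !mxE.
by rewrite !rowE row_of_pullback.
Qed.

Lemma pullback_id : pullback_mx id = 1%:M.
Proof. by apply/matrixP => i j; rewrite !mxE (inj_eq enum_val_inj). Qed.

Lemma pullback_tr f : injective f -> (pullback_mx f)^T *m pullback_mx f = 1%:M.
Proof.
move=> f_inj; apply/matrixP => i j; rewrite !mxE.
under eq_bigr do rewrite !mxE.
rewrite (sum_delta (fun d => (d == f (enum_val i))%:R)).
by rewrite (inj_eq f_inj) (inj_eq enum_val_inj) eq_sym.
Qed.

(** The indicator functions of the cycles of [f], which are the rows of [R], are invariant and
    linearly independent. *)
Lemma fcard_le_rank f :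
  injective f -> (fcard f predT <= \rank (kermx (pullback_mx f - 1%:M)))%N.
Proof.
move=> f_inj; pose A := [set d | froots f d].
have -> : fcard f predT = #|A| by apply: eq_card => d; rewrite !inE andbT.
pose R : 'M[rat]_(#|A|, n) := \matrix_(i, j) (enum_val i == froot f (enum_val j))%:R.
have Rfree : row_free R.
  apply/row_freeP; exists (\matrix_(j, i) (enum_val j == enum_val i)%:R).
  apply/matrixP => i i'; rewrite !mxE; under eq_bigr do rewrite !mxE.
  rewrite (sum_delta (fun d => (enum_val i == froot f d)%:R)).
  have := enum_valP i'; rewrite inE => /eqP ->.
  by rewrite (inj_eq enum_val_inj).
have rootf d : froot f (f d) = froot f d.
  apply/esym/eqP; rewrite root_connect ?fconnect1 //; exact: fconnect_sym.
have Rker : (R <= kermx (pullback_mx f - 1%:M))%MS.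
  apply/sub_kermxP; rewrite mulmxBr mulmx1; apply/eqP; rewrite subr_eq0; apply/eqP.
  apply/matrixP => i j; rewrite !mxE; under eq_bigr do rewrite !mxE.
  by rewrite (sum_delta (fun d => (enum_val i == froot f d)%:R)) rootf.
by have := mxrankS Rker; rewrite (eqP Rfree).
Qed.

End FunctionMatrix.

(* H_1 of the sphere vanishes: every cycle [z] is the coboundary of a function
   [y] on the faces.  Both the space of cycles and that of boundaries have
   dimension #faces - 1, by Euler's formula. *)
Lemma spherical_cycle (D : finType) (rot edge : D -> D) (z : D -> rat) :
  injective rot -> involutive edge -> (forall d, edge d != d) ->
  (forall h : D -> rat, h \o rot =1 h -> h \o edge =1 h -> forall d d', h d = h d') ->
  spherical rot edge -> (forall d, z (edge d) = - z d) ->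
  (forall h : D -> rat, h \o rot =1 h -> \sum_d z d * h d = 0) ->
  exists2 y : D -> rat, forall d, y (rot (edge d)) = y d & forall d,
    z d = y (rot d) - y d.
Proof.
move=> rot_inj edgeK edge_neq conn /eqP euler z_edge z_rot.
have edge_inj := inv_inj edgeK.
pose n := #|D|.
have nE : n = (fcard edge predT * 2)%N.
  have ord2 d : fingraph.order edge d = 2%N.
    have cyc : fcycle edge [:: d; edge d] by rewrite /= edgeK !eqxx.
    by rewrite (order_cycle cyc) //= ?inE ?eqxx // eq_sym edge_neq.
  have <- : #|(predT : {pred D})| = n by apply: eq_card.
  apply/esym/(@fcard_order_set _ _ edge_inj 2%N predT) => //.
  by apply/fintype.subsetP => d _; rewrite inE /= ord2.
pose S := pullback_mx rot; pose A := pullback_mx edge.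
pose Phi := pullback_mx (rot \o edge).
have AA : A *m A = 1%:M.
  by rewrite pullback_comp -pullback_id; congr pullback_mx; apply/funext => d /=.
(* By connectedness, a space of functions invariant under [rot] and [edge] contains constants
   only. *)
have constP (M : 'M[rat]_n) : (forall r : 'rV_n,
  (r <= M)%MS -> r *m S = r /\ r *m A = r) ->
    (\rank M <= 1)%N.
  move=> inv; suff: (M <= (const_mx 1 : 'rV[rat]_n))%MS.
    by move/mxrankS/leq_trans; apply; apply: rank_leq_row.
  apply/row_subP => i; have [] := inv (row i M) (row_sub i M).
  set r := row i M; pose h d := r 0 (enum_rank d).
  rewrite -(row_ofK r) -/h !row_of_pullback => /row_of_inj hS /row_of_inj hA.
  case: (pickP (@predT D)) => [d0 _|noD]; last first.
    rewrite (_ : row_of h = 0) ?sub0mx //; apply/rowP => j.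
    by have := noD (enum_val j).
  apply/sub_rVP; exists (h d0); apply/rowP => j; rewrite !mxE mulr1.
  exact: conn.
(* An edge-invariant function v is the image of v/2 under A + 1. *)
have edge_rank : (fcard edge predT <= \rank (A + 1%:M)%R)%N.
  apply: leq_trans (fcard_le_rank edge_inj) (mxrankS _).
  have kA : kermx (A - 1%:M) *m A = kermx (A - 1%:M).
    by apply/eqP; rewrite -subr_eq0 -{2}[kermx _]mulmx1 -mulmxBr mulmx_ker.
  apply/submxP; exists (2^-1 *: kermx (A - 1%:M)).
  by rewrite -scalemxAl mulmxDr mulmx1 kA -mulr2n -scaler_nat scalerA mulVf ?scale1r.
(* The image of A - 1 lies in the kernel of A + 1. Permutation matrices being orthogonal, what is
   orthogonal to the images of A - 1 and S - 1 is invariant under both permutations, hence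
   constant. *)
have sum_rank : (n.-1 <= \rank (kermx (A + 1%:M)%R + (S - 1%:M)%R)%MS)%N.
  apply: leq_trans (_ : \rank ((A - 1%:M)%R + (S - 1%:M)%R)%MS <= _)%N; last first.
    apply/mxrankS/addsmxS => //; apply/sub_kermxP.
    by rewrite mulmxDr mulmx1 mulmxBl AA mul1mx addrC subrKA subrr.
  rewrite addsmxE -mxrank_tr tr_col_mx; set M := row_mx _ _.
  suff : (\rank (kermx M) <= 1)%N.
    by rewrite mxrank_ker; have := rank_leq_row M; rewrite -/n; lia.
  apply: constP.
  move=> r /sub_kermxP; rewrite mul_mx_row => /eqP; rewrite row_mx_eq0.
  have inv f : injective f -> r *m (pullback_mx f - 1%:M)^T == 0 ->
    r *m pullback_mx f = r.
    move=> f_inj; rewrite linearB /= trmx1 mulmxBr mulmx1 subr_eq0 => /eqP e.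
    by rewrite -{1}e -mulmxA pullback_tr // mulmx1.
  by case/andP => /(inv _ edge_inj) rA /(inv _ rot_inj) rS.
(* The cycles are the edge-antisymmetric functions in the image of S - 1. Writing V and E for the
   numbers of vertices and edges, their dimension is at most (n - E) + (n - V) - (n - 1). *)
have Z_rank : (\rank (kermx (A + 1%:M)%R :&: (S - 1%:M)%R)%MS + fcard edge predT
               + fcard rot predT <= n.+1)%N.
  have := mxrank_sum_cap (kermx (A + 1%:M)) (S - 1%:M).
  have := fcard_le_rank rot_inj; rewrite !mxrank_ker.
  have := rank_leq_row (S - 1%:M); move: edge_rank sum_rank; rewrite -/S -/n; lia.
(* The boundaries, images of the functions on faces. Only constants are killed, so the dimension is
   at least the number of faces minus 1. *)
pose B := kermx (Phi - 1%:M) *m (S - 1%:M).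
have PhiE : Phi = S *m A by rewrite pullback_comp.
have B_rank : (fcard (rot \o edge) predT <= (\rank B).+1)%N.
  apply: leq_trans (fcard_le_rank (inj_comp rot_inj edge_inj)) _.
  rewrite -(mxrank_mul_ker _ (S - 1%:M)) -addn1 leq_add2l; apply: constP => r.
  rewrite sub_capmx => /andP [/sub_kermxP + /sub_kermxP].
  rewrite !mulmxBr mulmx1 => /eqP; rewrite subr_eq0 -/Phi PhiE mulmxA => /eqP rPhi.
  by move=> /eqP; rewrite subr_eq0 => /eqP rS; split=> //; rewrite -{1}rS.
have BZ : (B <= kermx (A + 1%:M)%R :&: (S - 1%:M)%R)%MS.
  rewrite sub_capmx submxMl andbT; apply/sub_kermxP.
  have kPhi : kermx (Phi - 1%:M) *m S *m A = kermx (Phi - 1%:M).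
    apply/eqP; rewrite -mulmxA -PhiE -subr_eq0 -{2}[kermx _]mulmx1 -mulmxBr.
    by rewrite mulmx_ker.
  have kS : kermx (Phi - 1%:M) *m A = kermx (Phi - 1%:M) *m S.
    by rewrite -{1}kPhi -mulmxA AA mulmx1.
  rewrite /B !(mulmxBr, mulmxDr, mulmx1, mulmxBl) kPhi kS.
  by rewrite addrC subrKA subrr.
(* With n = 2E, Euler's formula turns the bound n + 1 - E - V for cycles into the bound for
   boundaries. *)
have ZB : (kermx (A + 1%:M)%R :&: (S - 1%:M)%R <= B)%MS.
  rewrite -(geq_leqif (mxrank_leqif_sup BZ)).
  move: Z_rank B_rank euler; rewrite nE; lia.
have zZ : (row_of z <= kermx (A + 1%:M)%R :&: (S - 1%:M)%R)%MS.
  rewrite sub_capmx; apply/andP; split.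
    apply/sub_kermxP; rewrite mulmxDr mulmx1 row_of_pullback; apply/rowP => i.
    by rewrite !mxE /= z_edge addNr.
  (* Membership in the image of S - 1 is orthogonality to the columns of its cokernel, and these are
     [rot]-invariant functions. *)
  rewrite submxE; have := mulmx_coker (S - 1%:M); move: (cokermx _) => C SC.
  apply/eqP/rowP => j; rewrite !mxE.
  pose h d := C (enum_rank d) j.
  rewrite -[RHS](z_rot h); last first.
    move=> d /=; move: SC; rewrite mulmxBl mul1mx => /eqP;
      rewrite subr_eq0 => /eqP/matrixP.
    move/(_ (enum_rank (rot d)) j); rewrite !mxE /h => <-.
    transitivity (\sum_(l < n) h (enum_val l) * (enum_val l == d)%:R);
      last exact: sum_delta.
    apply: eq_bigr => l _; rewrite !mxE enum_rankK (inj_eq rot_inj) mulrC eq_sym.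
    by rewrite /h enum_valK.
  rewrite [RHS](reindex_onto (@enum_val D predT) enum_rank) /=; last by move=> d _;
    rewrite enum_rankK.
  rewrite [RHS](eq_bigl predT); last by move=> i; rewrite /= enum_valK eqxx.
  by apply: eq_bigr => i _; rewrite mxE /h enum_valK.
have /submxP [W zE] := submx_trans zZ ZB.
pose r := W *m kermx (Phi - 1%:M).
pose y d := r 0 (enum_rank d); have ry : row_of y = r by exact: row_ofK.
exists y.
  apply: row_of_inj; change (row_of (y \o (rot \o edge)) = row_of y).
  rewrite -row_of_pullback ry -/Phi.
  by apply/eqP; rewrite -subr_eq0 -{2}[r]mulmx1 -mulmxBr -mulmxA mulmx_ker mulmx0.
apply: row_of_inj; rewrite zE /B mulmxA -/r mulmxBr mulmx1 -ry row_of_pullback.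
by apply/rowP => i; rewrite !mxE.
Qed.

(** * Half-edges of a smoothing *)

Section Orbit.

Variables (D : finType) (e m : D -> D) (omega : D -> int) (d0 : D).

Hypothesis eK : involutive e.
Hypothesis mK : involutive m.
Hypothesis e_neq : forall d, e d != d.
Hypothesis m_neq : forall d, m d != d.
Hypothesis omega_m : forall d, omega (m d) = - omega d.
Hypothesis omega_d0 : omega d0 = 0.

Local Notation phi := (m \o e).
Local Notation on := (fconnect phi d0).

(** In [m] the interval is closed up by joining [d0] to [m d0]; this arc is left out, in both
    directions. *)
Definition state_arcs : seq (arc D) :=
  [seq (d, e d, 0) | d <- enum D] ++
  [seq (d, m d, omega d) | d <- enum D & (d != d0) && (d != m d0)].

Lemma phi_inj : injective phi.
Proof. exact: inj_comp (inv_inj mK) (inv_inj eK). Qed.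

Lemma on_phi d : on (phi d) = on d.
Proof. by rewrite -(same_fconnect1_r phi_inj). Qed.

Lemma on_em d : on (e (m d)) = on d.
Proof. by rewrite -on_phi /= eK mK. Qed.

Lemma on_me d : on (m (e d)) = on d.
Proof. exact: on_phi. Qed.

(** No component is traversed in both directions. A path of length k + 2 from [d] to [m d] loses a
    step at each end and becomes a path of length k from [phi d] to [m (phi d)], until [m] or [e]
    would have a fixed point. *)
Lemma iter_phi_neq k d : m d != iter k phi d.
Proof.
have [n] := ubnP k; elim: n k d => // n IH [|[|k]] d kn.
- exact: m_neq.
- by rewrite /= (inj_eq (inv_inj mK)) eq_sym e_neq.
- have /eqP ne : m (phi d) != iter k phi (phi d) by apply: IH; exact: ltnW.
  apply/eqP => eq; apply: ne; rewrite -iterSr /= mK.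
  by apply: (inv_inj eK); rewrite eK; apply: (inv_inj mK); rewrite eq.
Qed.

Lemma on_m d : on d -> ~~ on (m d).
Proof.
move=> onD; apply/negP => onm.
have : fconnect phi d (m d) by apply: connect_trans onm; rewrite fconnect_sym //;
  exact: phi_inj.
by move=> /iter_findex h; have := iter_phi_neq (findex phi d (m d)) d; rewrite h eqxx.
Qed.

Lemma on_e d : on d -> ~~ on (e d).
Proof. by move=> h; rewrite -[e d]mK; apply: on_m; rewrite on_me. Qed.

Lemma on_d0 : on d0. Proof. exact: connect0. Qed.

Lemma findex_phi d : on d -> phi d != d0 ->
  findex phi d0 (phi d) = (findex phi d0 d).+1.
Proof.
move=> onD ne; have lt := findex_max onD.
have dE := iter_findex onD.
rewrite -{1}dE -iterS findex_iter // ltn_neqAle lt andbT.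
apply: contraNneq ne => eq.
have := iter_order phi_inj d0; rewrite -eq iterS dE => ->.
by rewrite eqxx.
Qed.

Definition length_at (k : nat) : int := \sum_(i < k) omega (e (iter i phi d0)).

(** The length of the interval from [d0] to the edge containing [d], whichever half of that edge [d]
    is; its value off the interval is irrelevant. *)
Definition potential d : int :=
  if on d then length_at (findex phi d0 d)
  else if on (e d) then length_at (findex phi d0 (e d)) else 0.

Lemma potential_e d : on d || on (e d) -> potential (e d) = potential d.
Proof.
rewrite /potential eK; case: (boolP (on d)) => [/on_e/negPf -> //|_ /= ->].
by [].
Qed.

Lemma potential_m d : on d || on (e d) -> d != d0 -> d != m d0 ->
  potential (m d) = potential d + omega d.
Proof.
move=> ond dd0 dmd0; rewrite /potential;
  case: (boolP (on d)) ond => [ond _|nond /= ond].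
  rewrite (negPf (on_m ond)) on_em ond.
  have -> : findex phi d0 d = (findex phi d0 (e (m d))).+1.
    by rewrite -findex_phi ?on_em //= eK mK.
  rewrite /length_at big_ord_recr /= iter_findex ?on_em // eK omega_m.
  by rewrite addrNK.
have onmd : on (m d) by rewrite -[d]eK on_me.
rewrite onmd ond.
have mdE : m d = phi (e d) by rewrite /= eK.
rewrite mdE findex_phi //; last first.
  by rewrite -mdE; apply: contraNneq dmd0 => <-; rewrite mK.
by rewrite /length_at big_ord_recr /= iter_findex // eK.
Qed.

Lemma potential_finish : potential (m d0) = \sum_(d | on d) omega (m d).
Proof.
rewrite /potential (negPf (on_m on_d0)) on_em on_d0.
have -> : \sum_(d | on d) omega (m d) =
          \sum_(i < fingraph.order phi d0) omega (m (iter i phi d0)).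
  rewrite (eq_bigl (mem (fingraph.orbit phi d0))); last by move=> d;
    exact: fconnect_orbit.
  rewrite -big_uniq ?orbit_uniq // /fingraph.orbit.
  rewrite (big_nth d0) size_traject big_mkord; apply: eq_bigr => i _.
  by rewrite nth_traject.
rewrite -orderSpred big_ord_recl /= omega_m omega_d0 oppr0 add0r.
(* [phi] sends [e (m d0)] back to [d0], so this half-edge is the last one of the orbit. *)
suff -> : findex phi d0 (e (m d0)) = (fingraph.order phi d0).-1.
  by apply: eq_bigr => i _; rewrite mK.
have ond : on (e (m d0)) by rewrite on_em on_d0.
have lt := findex_max ond.
have h : iter (findex phi d0 (e (m d0))).+1 phi d0 = d0 by rewrite iterS
  iter_findex //= eK mK.
apply/eqP; rewrite -eqSS orderSpred eqn_leq lt /=.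
rewrite leqNgt; apply/negP => lt'.
by have := findex_iter lt'; rewrite h findex0.
Qed.

Local Notation joined := (fun d d' : D => (d' == e d) || (d' == m d)).

Lemma joined_sym : connect_sym joined.
Proof.
apply: sym_connect_sym => x y.
by rewrite !(eq_sym x) (can2_eq eK eK) (can2_eq mK mK).
Qed.

Lemma joined_component d : connect joined d0 d -> on d || on (e d).
Proof.
have cl : closed joined [pred x | on x || on (e x)].
  apply: intro_closed; first exact: joined_sym.
  move=> x y /orP [] /eqP ->; rewrite !inE; first by rewrite eK orbC.
  by rewrite on_em -[in on (m x)](eK x) on_me orbC.
by move=> /(closed_connect cl); rewrite !inE on_d0 => <-.
Qed.

(** Without the closing arc, the two ends are still linked along the interval itself. Hence the
    components are those of the closed-up smoothing, which [n_comp] counts. *)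
Lemma linked_d0 : linked state_arcs d0 (m d0).
Proof.
have arc_e d : linked state_arcs d (e d).
  apply: (linked_arc (a := (d, e d, 0))); rewrite mem_cat.
  by rewrite (map_f (fun d => (d, e d, 0) : arc D)) ?mem_enum.
have arc_m d : d != d0 -> d != m d0 -> linked state_arcs d (m d).
  move=> n1 n2; apply: (linked_arc (a := (d, m d, omega d))); rewrite mem_cat.
  by rewrite (map_f (fun d => (d, m d,
    omega d) : arc D)) ?orbT // mem_filter n1 n2 mem_enum.
have walk k : (k < fingraph.order phi d0)%N -> linked state_arcs d0 (iter k phi d0).
  elim: k => [_|k IH lt]; first exact: linked_refl.
  apply: (linked_trans (IH (ltnW lt))); set x := iter k phi d0.
  have onx : on x by apply: fconnect_iter.
  rewrite iterS -/x /=; apply: (linked_trans (arc_e x)); apply: arc_m.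
    by apply: contraNneq (on_e onx) => ->; apply: on_d0.
  apply/eqP => ex; have := findex_iter lt; rewrite iterS -/x /= ex mK.
  by rewrite findex0.
have ond : on (e (m d0)) by rewrite on_em on_d0.
apply: linked_trans (walk _ (findex_max ond)) _; rewrite iter_findex //.
apply: linked_sym; exact: arc_e.
Qed.

Lemma joined_linked p q : connect joined p q -> linked state_arcs p q.
Proof.
case/connectP => s; elim: s p => [|x s IH] p /= => [_ ->|]; first exact: linked_refl.
case/andP => px /IH sx /sx; apply: linked_trans.
case/orP: px => /eqP ->.
  apply: (linked_arc (a := (p, e p, 0))); rewrite mem_cat.
  by rewrite (map_f (fun d => (d, e d, 0) : arc D)) ?mem_enum.
case: (eqVneq p d0) => [->|n1]; first exact: linked_d0.
case: (eqVneq p (m d0)) => [->|n2]; first by rewrite mK; apply: linked_sym;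
  exact: linked_d0.
apply: (linked_arc (a := (p, m p, omega p))); rewrite mem_cat.
by rewrite (map_f (fun d => (d, m d,
  omega d) : arc D)) ?orbT // mem_filter n1 n2 mem_enum.
Qed.

Lemma mem_points_state_arcs d : d \in points state_arcs.
Proof.
apply/mem_points; exists (d, e d, 0); last by rewrite eqxx.
by rewrite mem_cat (map_f (fun d => (d, e d, 0) : arc D)) ?mem_enum.
Qed.

Lemma state_arcs_evaluates :
  evaluates d0 (m d0) state_arcs (n_comp joined predT).-1 (\sum_(d | on d) omega (m
    d)).
Proof.
pose r0 := fingraph.root joined d0.
(* The root of the component of [d0] comes first, so that the interval gets number 0. *)
pose rs := r0 :: rem r0 (enum (roots joined)).
have r0_in : r0 \in enum (roots joined) by rewrite mem_enum; apply: roots_root;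
  exact: joined_sym.
have perm_rs : perm_eq rs (enum (roots joined)) by rewrite perm_sym perm_to_rem.
have rs_mem x : (x \in rs) = roots joined x by rewrite (perm_mem perm_rs) mem_enum.
have uniq_rs : uniq rs by rewrite (perm_uniq perm_rs) enum_uniq.
have root_in d : fingraph.root joined d \in rs by rewrite rs_mem;
  apply: roots_root; exact: joined_sym.
have size_rs : size rs = n_comp joined predT.
  by rewrite (perm_size perm_rs) -cardE; apply: eq_card => x; rewrite !inE andbT.
pose g d := index (fingraph.root joined d) rs.
have gP d d' : connect joined d d' -> g d = g d'.
  by move=> c; congr index; apply/(fingraph.rootP joined_sym).
have gI d d' : g d = g d' -> connect joined d d'.
  move=> eg; apply/(fingraph.rootP joined_sym).
  by rewrite -(nth_index d0 (root_in d)) -(nth_index d0 (root_in d')) -/(g d) eg.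
have g0 : g d0 = 0%N by rewrite /g /rs /= eqxx.
have pts := mem_points_state_arcs.
have joined1 d d' : joined d d' -> connect joined d d' by move=> j; apply: connect1.
have comp d : g d = 0%N -> on d || on (e d).
  by rewrite -g0 => /esym/gI; apply: joined_component.
exists g, potential; split.
- move=> a; rewrite mem_cat => /orP [] /mapP [d _ ->] /=; apply/gP/joined1;
  by rewrite eqxx ?orbT.
- move=> a; rewrite mem_cat => /orP [] /mapP [d dP ->] /= /comp h.
    by rewrite potential_e // addr0.
  by move: dP; rewrite mem_filter => /andP [/andP [n1 n2] _]; apply: potential_m.
- split; first split=> //.
    by rewrite -(gP d0) //; apply: joined1; rewrite eqxx orbT.
  split; last exact: potential_finish.
  by rewrite /potential on_d0 findex0 /length_at big_ord0.
- have k_lt i : (i <= (n_comp joined predT).-1)%N = (i < size rs)%N.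
    by rewrite -ltnS prednK -size_rs.
  move=> i; rewrite k_lt; split=> [lt|[d _ <-]]; last by rewrite index_mem.
  exists (nth d0 rs i) => //.
  have := mem_nth d0 lt; rewrite rs_mem => /eqP rr.
  by rewrite /g rr index_uniq.
- by move=> p q _ _ /gI; apply: joined_linked.
Qed.

End Orbit.

Lemma link_sub (P : eqType) (L M : seq (arc P)) :
  (forall a, a \in L -> link M a) -> (forall a,
    a \in M -> link L a) -> link L =1 link M.
Proof.
have sub (L1 L2 : seq (arc P)) : (forall a, a \in L1 -> link L2 a) -> forall a,
  link L1 a -> link L2 a.
  by move=> h a /orP [/h //|/h]; rewrite link_flip.
by move=> h1 h2 a; apply/idP/idP; apply: sub.
Qed.

Lemma mem_link (P : eqType) (L : seq (arc P)) a : a \in L -> link L a.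
Proof. by move=> h; rewrite /link h. Qed.

Lemma nth_strand a w b i a0 : (i <= size w)%N ->
  nth a0 (strand a w b) i =
  (if i is j.+1 then (nth None (map Some w) j, false) else a,
   if (i < size w)%N then (nth None (map Some w) i, true) else b, 0).
Proof.
elim: w a i => [|x w IH] a [|i] //=; rewrite ltnS => le_i.
by rewrite IH //; case: i le_i.
Qed.

Lemma size_strand a w b : size (strand a w b) = (size w).+1.
Proof. by elim: w a => //= x w IH a; rewrite IH. Qed.

(** The counterpart of [smoothing] for half-edges named by their item instead of their place. *)
Definition mate (S : crossing -> bool) (p : point) : point :=
  match p with
  | (Some (inl (c, o)), x) => (Some (inl (c, ~~ o)), x (+) c.2 (+) ~~ S c)
  | (it, x) => (it, ~~ x)
  end.

Definition mate_weight (S : crossing -> bool) (p : point) : int :=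
  match p with
  | (Some (inl (c, o)), x) => height (c, o) x - height (c,
    ~~ o) (x (+) c.2 (+) ~~ S c)
  | _ => 0
  end.

Definition bivalent_arcs (w : seq item) : seq (arc point) :=
  [seq ((Some (inr j), true), (Some (inr j), false), 0) | j <- pmap rank_of w].

Definition smooth_all (S : crossing -> bool) (cs : seq crossing) : seq (arc point) :=
  flatten [seq smooth_arcs (S c) c | c <- cs].

Section Dart.

Variable w : seq item.

Hypothesis w_uniq : uniq w.
Hypothesis w_mate : forall c o, inl (c, o) \in w -> inl (c, ~~ o) \in w.

Definition point_of (d : dart w) : point := (item_at d.1, d.2).

Lemma item_at_place x : x \in w -> item_at (place w x) = Some x.
Proof.
move=> xw; rewrite /item_at /place inordK ?ltnS ?index_mem //=.
by rewrite (nth_map x) ?index_mem // nth_index.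
Qed.

Lemma item_at_inj : injective (@item_at w).
Proof.
move=> i j /eqP; rewrite /item_at nth_uniq //= ?size_map ?ltn_ord //.
  by move=> /eqP/val_inj.
rewrite map_inj_uniq ?w_uniq ?andbT //; last by move=> x y [].
by apply/mapP => -[].
Qed.

Lemma point_of_inj : injective point_of.
Proof. by move=> [i x] [j y] [] /item_at_inj -> ->. Qed.

Lemma item_atP (i : 'I_(size w).+1) x : item_at i = Some x -> x \in w.
Proof.
rewrite /item_at; case: i => -[//|i] /= lt; rewrite ltnS in lt.
by rewrite (nth_map x) // => -[<-]; rewrite mem_nth.
Qed.

Lemma item_at_None (i : 'I_(size w).+1) : item_at i = None -> i = ord0.
Proof. by move=> h; apply: item_at_inj; rewrite h. Qed.

Lemma strand_edgeK n : involutive (@strand_edge n).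
Proof. by case=> i [] /=; rewrite /strand_edge /= ?ordSK ?ord_predK. Qed.

Lemma strand_edge_neq n (d : 'I_n.+1 * bool) : strand_edge d != d.
Proof. by case: d => i []; rewrite /strand_edge /=; apply/eqP => -[]. Qed.

Lemma strand_point_of :
  strand start w finish =
  [seq (point_of (i, false), point_of (strand_edge (i, false)), 0)
     | i <- enum 'I_(size w).+1].
Proof.
pose a0 : arc point := (start, start, 0).
apply: (@eq_from_nth _ a0) => [|i]; rewrite size_strand.
  by rewrite size_map size_enum_ord.
move=> lt_i.
rewrite nth_strand // (nth_map ord0) ?size_enum_ord //.
have -> : nth ord0 (enum 'I_(size w).+1) i = Ordinal lt_i by apply: val_inj;
  rewrite /= nth_enum_ord.
rewrite /point_of /strand_edge /item_at /=; congr (_, _, _).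
  by case: i lt_i.
case: ltnP => [lt|ge]; first by rewrite modn_small.
(* The last edge wraps around to place 0, which bears no item: its incoming half-edge is
   [finish]. *)
have -> : i = size w by apply/eqP; rewrite eqn_leq ge -ltnS lt_i.
by rewrite modnn.
Qed.

End Dart.

Lemma mateK S : involutive (mate S).
Proof.
by case=> [[[[c o]|j]|] x] //=; rewrite ?negbK //; case: x; case: c.2; case: (S c).
Qed.

Lemma mate_neq S p : mate S p != p.
Proof.
apply/eqP; case: p => [[[[c o]|j]|] x] //= [].
- by case: o.
- by case: x.
- by case: x.
Qed.

Lemma mate_weight_mate S p : mate_weight S (mate S p) = - mate_weight S p.
Proof.
case: p => [[[[c o]|j]|] x] /=; rewrite ?oppr0 // negbK opprB; congr (_ - _).
by congr height; case: x; case: c.2; case: (S c).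
Qed.

Section StateArcs.

Variables (K : seq pass) (s : state K) (w : seq item).

Hypothesis w_uniq : uniq w.
Hypothesis w_mate : forall c o, inl (c, o) \in w -> inl (c, ~~ o) \in w.
Hypothesis w_K : forall p, (inl p \in w) = (p \in K).

Local Notation S := (state_at s).
Local Notation start_dart := ((ord0, false) : dart w).

Lemma point_of_rot (d : dart w) c o : item_at d.1 = Some (inl (c, o)) ->
  point_of (strand_rot d) = (Some (inl (c, ~~ o)), turn o c.2 d.2).
Proof.
move=> h; rewrite /strand_rot h /point_of /= item_at_place //.
by apply: w_mate; apply: item_atP h.
Qed.

Lemma point_of_smoothing (d : dart w) : point_of (smoothing s d) = mate S (point_of
  d).
Proof.
rewrite /smoothing; case h : (item_at d.1) => [[[c o]|j]|]; last 2 first.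
- by rewrite /point_of /= h.
- by rewrite /point_of /= h.
rewrite [in RHS]/point_of h /=.
have h1 := point_of_rot h.
have h2 : point_of (strand_rot (strand_rot d)) =
    (Some (inl (c, o)), turn (~~ o) c.2 (turn o c.2 d.2)).
  have [e1 e2] := h1; rewrite (point_of_rot e1) negbK.
  by rewrite -/(turn o c.2 d.2) -e2.
have h3 : point_of (strand_rot (strand_rot (strand_rot d))) =
    (Some (inl (c, ~~ o)), turn o c.2 (turn (~~ o) c.2 (turn o c.2 d.2))).
  have [e1 e2] := h2; rewrite (point_of_rot e1).
  by rewrite -e2.
case: ifP => e; rewrite ?h1 ?h3; congr (_, _); move: e; rewrite /turn;
  by case: (state_at s c); case: (o); case: (c.2); case: (d.2).
Qed.

Lemma smoothingK : involutive (@smoothing K s w).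
Proof. by move=> d; apply: (point_of_inj w_uniq);
  rewrite !point_of_smoothing mateK. Qed.

Lemma smoothing_neq (d : dart w) : smoothing s d != d.
Proof.
by apply: contraNneq (mate_neq S (point_of d)) => e; rewrite -point_of_smoothing e.
Qed.

Lemma smoothing_start : smoothing s start_dart = (ord0, true).
Proof. by []. Qed.

Definition dart_weight (d : dart w) : int := mate_weight S (point_of d).

Lemma dart_weight_smoothing d : dart_weight (smoothing s d) = - dart_weight d.
Proof. by rewrite /dart_weight point_of_smoothing mate_weight_mate. Qed.

Lemma mem_smooth_all (T : crossing -> bool) cs c x :
  c \in cs -> smooth_arc (T c) c x \in smooth_all T cs.
Proof.
move=> cP; apply/flatten_mapP; exists c => //; rewrite /smooth_arcs !inE.
by case: x; rewrite eqxx ?orbT.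
Qed.

Lemma mem_ranks j : (j \in pmap rank_of w) = (inr j \in w).
Proof. by rewrite mem_pmap; apply/mapP/idP => [[[p|i] // iw [->]]|jw];
  last exists (inr j). Qed.

(** The matching arc omitted on the left is the one at place 0, and on the right no smoothing arc
    touches [start] or [finish]. Elsewhere each matching arc is listed in both directions on the
    left and in one on the right, which [link] does not see. *)
Lemma link_state_arcs :
  link (map (map_arc (@point_of w))
          (state_arcs (@strand_edge (size w)) (@smoothing K s w) dart_weight
            start_dart)) =1
  link (strand start w finish ++ smooth_all S (crossings K) ++ bivalent_arcs w).
Proof.
apply: link_sub => a.
  case/mapP => b + ->; rewrite mem_cat => /orP [/mapP [[i x] _ ->]|].
    rewrite /map_arc /= link_cat; apply/orP; left; rewrite strand_point_of.
    case: x; last by apply/mem_link/mapP; exists i; rewrite ?mem_enum.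
    rewrite -link_flip; apply/mem_link/mapP; exists (ord_pred i);
      rewrite ?mem_enum //.
    by rewrite /flip /= /strand_edge /= ord_predK.
  case/mapP => [[i x]]; rewrite mem_filter smoothing_start => /andP [ix _] -> /=.
  rewrite /map_arc /= /dart_weight point_of_smoothing /point_of /=.
  case h : (item_at i) => [[[c o]|j]|]; last first.
  - by move: ix; rewrite (item_at_None w_uniq h); case: (x).
  - rewrite !link_cat; apply/orP; right; apply/orP; right.
    have jw : j \in pmap rank_of w by rewrite mem_ranks; apply: item_atP h.
    case: (x); last rewrite -link_flip; apply/mem_link/mapP; by exists j.
  - have cK : c \in crossings K.
      rewrite mem_crossings -w_K; have := item_atP h; case: (o) => // /w_mate.
      by [].
    rewrite !link_cat; apply/orP; right; apply/orP; left.
    case: o h => h; last by apply/mem_link/mem_smooth_all.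
    rewrite -link_flip; apply/mem_link.
    pose y := x (+) c.2 (+) ~~ S c.
    have ex : y (+) c.2 (+) ~~ S c = x.
      by rewrite /y; case: (x); case: c.2; case: (state_at s c).
    by have := mem_smooth_all S y cK; rewrite /smooth_arc ex /flip /= opprB.
have arc_m it x : it \in w ->
    link (map (map_arc (@point_of w))
          (state_arcs (@strand_edge (size w)) (@smoothing K s w) dart_weight
            start_dart))
      ((Some it, x), mate S (Some it, x), mate_weight S (Some it, x)).
  move=> itw; pose d : dart w := (place w it, x).
  have pd : point_of d = (Some it, x) by rewrite /point_of /= item_at_place.
  rewrite -pd -point_of_smoothing -/(dart_weight d).
  apply: mem_link; rewrite map_cat mem_cat; apply/orP; right.
  apply/mapP; exists (d, smoothing s d, dart_weight d) => //.
  apply: (map_f (fun d => (d, smoothing s d, dart_weight d) : arc (dart w))).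
  rewrite mem_filter mem_enum andbT smoothing_start.
  have np y : d != (ord0, y).
    apply/eqP => e; have : (point_of d).1 = None by rewrite e.
    by rewrite pd.
  by rewrite !np.
rewrite !mem_cat => /or3P [].
- rewrite strand_point_of => /mapP [i _ ->].
  apply: mem_link; rewrite map_cat mem_cat; apply/orP; left.
  apply/mapP; exists ((i, false), strand_edge (i, false), 0) => //.
  by apply: (map_f (fun d => (d, strand_edge d, 0) : arc (dart w))); rewrite mem_enum.
- case/flatten_mapP => c; rewrite mem_crossings -w_K => cw.
  have cw' : inl (c, false) \in w by apply: w_mate cw.
  by rewrite !inE => /orP [] /eqP ->; apply: (arc_m (inl (c, false))).
- case/mapP => j; rewrite mem_ranks => jw ->.
  exact: (arc_m (inr j) true).
Qed.

(** The count by orbits on half-edges is carried to points along a left inverse of [point_of]. *)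
Lemma state_evaluates :
  evaluates start finish
    (strand start w finish ++ smooth_all S (crossings K) ++ bivalent_arcs w)
    (loops s w) (\sum_(d | on_interval s d) dart_weight (smoothing s d)).
Proof.
apply: (evaluates_link_imp link_state_arcs).
have ev := state_arcs_evaluates (@strand_edgeK _) smoothingK (@strand_edge_neq _)
  smoothing_neq dart_weight_smoothing (erefl : dart_weight start_dart = 0).
pose h (p : point) : dart w := odflt start_dart [pick d | point_of d == p].
have hK : cancel (@point_of w) h.
  move=> d; rewrite /h; case: pickP => [d' /eqP /(point_of_inj w_uniq) //|/(_ d)].
  by rewrite eqxx.
apply: (@evaluates_map _ _ h start finish); rewrite ?points_map_arc.
- by move=> p q /mapP [d _ ->] /mapP [d' _ ->]; rewrite !hK => ->.
- have -> : start = point_of start_dart by [].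
  by rewrite map_f // mem_points_state_arcs.
- have -> : finish = point_of (smoothing s start_dart) by rewrite smoothing_start.
  by rewrite map_f // mem_points_state_arcs.
have -> : h start = start_dart by rewrite -[RHS]hK.
have -> : h finish = smoothing s start_dart by rewrite -[RHS]hK smoothing_start.
rewrite -map_comp (eq_map (g := id)) ?map_id //.
by move=> [[d d'] n]; rewrite /map_arc /= !hK.
Qed.

End StateArcs.

(** Intersections with the shortcut are bivalent points of weight 0, so they can be contracted away:
    the shortcut is erased from the state. *)
Lemma value_bivalent a w b R :
  uniq w -> (forall j x, inr j \in w -> (Some (inr j), x) \notin [:: a;
    b] ++ points R) ->
  value (strand a w b ++ bivalent_arcs w ++ R) =
  value (strand a (map inl (pmap pass_of w)) b ++ R).
Proof.
elim: w a R => [|[p|j] w IH] a R //= /andP [xw uw] out.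
  have -> : (a, (Some (inl p), true), 0) :: strand (Some (inl p), false) w b
      ++ bivalent_arcs (inl p :: w) ++ R =
    [:: (a, (Some (inl p), true), 0)] ++ strand (Some (inl p), false) w b
      ++ bivalent_arcs w ++ R by [].
  have lk (L1 L2 : seq (arc point)) : link ([:: (a, (Some (inl p), true),
    0)] ++ L1 ++ L2 ++ R) =1
      link (L1 ++ L2 ++ (a, (Some (inl p), true), 0) :: R).
    by apply: link_perm; apply/permP => f; rewrite !count_cat /=; lia.
  rewrite (value_link (lk _ _)) IH //; first apply: value_link.
    by apply: link_perm; rewrite -[_ :: R]cat1s perm_catCA.
  move=> j x jw; have := out j x; rewrite inE jw orbT => /(_ erefl).
  by rewrite points_cons /= !inE !negb_or => /and3P [-> -> ->].
have outj x : (Some (inr j), x) \notin [:: a; b] ++ points R.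
  by apply: out; rewrite inE eqxx.
have [y [T F]] : exists (y : point) (T : seq (arc point)), forall q,
  strand q w b = (q, y, 0) :: T.
  by case: (w) => [|x w'] /=; [exists b, [::] | exists (Some x, true),
    (strand (Some x, false) w' b)].
have fresh x : (Some (inr j), x) \notin points ((a, y,
  0) :: T ++ bivalent_arcs w ++ R).
  have := outj x; rewrite -cat_cons -F !points_cat !mem_cat !inE !negb_or =>
    /andP [/andP [xa xb] ->].
  rewrite andbT; apply/andP; split; apply/negP.
    case/strand_points => [e|e|[z zw [e]]];
      [by rewrite e eqxx in xa | by rewrite e eqxx in xb |].
    by rewrite e zw in xw.
  case/mem_points => c /mapP [i]; rewrite mem_pmap => /mapP [[p|i'] // iw [->]] ->.
  by move=> /orP [] /eqP [e] _; rewrite e iw in xw.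
have -> : value ((a, (Some (inr j), true), 0) :: strand (Some (inr j), false) w b
    ++ bivalent_arcs (inr j :: w) ++ R) =
  value [:: (a, (Some (inr j), true), 0), ((Some (inr j), true), (Some (inr j),
    false), 0),
            ((Some (inr j), false), y, 0) & T ++ bivalent_arcs w ++ R].
  rewrite F; apply: value_link; apply: link_perm; rewrite perm_cons.
  have -> : bivalent_arcs (inr j :: w) =
      ((Some (inr j), true), (Some (inr j), false), 0) :: bivalent_arcs w by [].
  exact: (permEl (perm_catCA (_ :: T) [:: _] (bivalent_arcs w ++ R))).
have ft := fresh true; have ff := fresh false.
rewrite points_cons !inE /= !negb_or in ft; case/and3P: ft => ta ty tT.
rewrite points_cons !inE /= !negb_or in ff; case/and3P: ff => fa fy fT.
have tT' : (Some (inr j), true) \notin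
    points (((Some (inr j), false), y, 0) :: T ++ bivalent_arcs w ++ R).
  by rewrite points_cons /= !inE !negb_or ty tT !andbT; apply/eqP => -[].
have tf : (Some (inr j), true) != (Some (inr j), false) :> point by apply/eqP => -[].
have n0 x : (Some (inr j), x) != start by [].
have n1 x : (Some (inr j), x) != finish by [].
rewrite (value_contract 0 0 tT' ta tf (n0 _) (n1 _)) addr0.
rewrite (value_contract 0 0 fT fa fy (n0 _) (n1 _)) addr0.
rewrite -IH ?F // => i x iw.
by apply: out; rewrite inE iw orbT.
Qed.

(** * Winding numbers *)

Lemma strand_constant (T : Type) n (h : 'I_n.+1 * bool -> T) :
  (forall i x, i != ord0 -> h (i, ~~ x) = h (i, x)) ->
  (forall d, h (strand_edge d) = h d) -> forall d, h d = h (ord0, false).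
Proof.
move=> hf he.
have step (i : 'I_n.+1) : h (ordS i, true) = h (i, false) by rewrite -(he (i, false)).
have fwd k : (k <= n)%N -> h (inord k, false) = h (ord0, false).
  elim: k => [_|k IH lt]; first by congr (h (_, _)); apply: val_inj;
    rewrite /= inordK.
  rewrite -IH ?(ltnW lt) // -(step (inord k)).
  have -> : ordS (inord k) = inord k.+1 :> 'I_n.+1.
    by apply: val_inj; rewrite /= !inordK ?modn_small ?ltnS // ltnW.
  rewrite -(hf _ true) //; apply/eqP => /(congr1 val).
  by rewrite /= inordK.
move=> [i x]; have fi : h (i, false) = h (ord0, false).
  by rewrite -(fwd i) ?inord_val // -ltnS.
case: x => //; have [->|i0] := eqVneq i ord0; last by rewrite -(hf _ true) in fi *.
rewrite -(fwd n) // -(step (inord n)); congr (h (_, _)); apply: val_inj.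
by rewrite /= inordK // modnn.
Qed.

(** In the application [y] records the values of a function on faces along one side of a strand, and
    [t i] is its jump across the half-edge leaving that side at place [i]. *)
Lemma strand_telescope n (y z : 'I_n.+1 * bool -> rat) (t : 'I_n.+1 -> rat) :
  (forall d, y (strand_edge d) = y d + z d) -> (forall d,
    z (strand_edge d) = - z d) ->
  (forall i, i != ord0 -> y (i, false) = y (i, true) + z (i, true) + t i) ->
  y (ord0, true) + z (ord0, true) = y (ord0, false) + \sum_(i | i != ord0) t i.
Proof.
move=> ye ze yt.
have step (i : 'I_n.+1) : y (ordS i, true) + z (ordS i, true) = y (i, false).
  have := ye (i, false); have := ze (i, false).
  by rewrite /strand_edge /= => -> ->; rewrite addrK.
have fwd k : (k <= n)%N ->
    y (inord k, false) = y (ord0, false) + \sum_(i < k) t (inord i.+1).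
  elim: k => [_|k IH lt].
    by rewrite big_ord0 addr0; congr (y (_, _)); apply: val_inj; rewrite /= inordK.
  rewrite big_ord_recr /= addrA -IH ?(ltnW lt) // yt; last first.
    by apply/eqP => /(congr1 val); rewrite /= inordK.
  rewrite -(step (inord k)); have -> // : ordS (inord k) = inord k.+1 :> 'I_n.+1.
  by apply: val_inj; rewrite /= !inordK ?modn_small ?ltnS // ltnW.
have e0 : ordS (inord n) = ord0 :> 'I_n.+1 by apply: val_inj;
  rewrite /= inordK // modnn.
rewrite -{1 2}e0 step fwd //; congr (_ + _).
rewrite [RHS]big_mkcond big_ord_recl eqxx /= add0r; apply: eq_bigr => i _.
by congr t; apply: val_inj; rewrite /= inordK // ltnS.
Qed.

Section Winding.

Variables (K : seq pass) (s : state K) (w : seq item) (sg : seq bool).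

Hypothesis w_uniq : uniq w.
Hypothesis w_mate : forall c o, inl (c, o) \in w -> inl (c, ~~ o) \in w.
Hypothesis w_rank : forall j, (inr j \in w) = (j < size sg)%N.
Hypothesis w_spherical : spherical (@shortcut_rot w sg) (@shortcut_edge w sg).

Local Notation on := (@on_interval K s w).
Local Notation rot := (@shortcut_rot w sg).
Local Notation edge := (@shortcut_edge w sg).
Local Notation sm := (@smoothing K s w).

Lemma place_item (i : 'I_(size w).+1) x : item_at i = Some x -> place w x = i.
Proof.
by move=> h; apply: (item_at_inj w_uniq); rewrite h item_at_place //;
  apply: item_atP h.
Qed.

Lemma rot_crossing (i : 'I_(size w).+1) c o x : item_at i = Some (inl (c, o)) ->
  rot (inl (i, x)) = inl (place w (inl (c, ~~ o)), turn o c.2 x).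
Proof. by move=> h; rewrite /= h /strand_rot /= h. Qed.

Lemma rot_crossing2 (i : 'I_(size w).+1) c o x : item_at i = Some (inl (c, o)) ->
  rot (rot (inl (i, x))) = inl (i, ~~ x).
Proof.
move=> h; rewrite (rot_crossing _ h) (@rot_crossing _ c (~~ o)).
  rewrite negbK (place_item h); congr (inl (_, _)).
  by rewrite /turn; case: o {h}; case: c.2; case: x.
by rewrite item_at_place //; apply: w_mate; apply: item_atP h.
Qed.

Lemma rot_meet (i : 'I_(size w).+1) j x : item_at i = Some (inr j) ->
  rot (inl (i, x)) = inr (inord j.+1, turn false (nth true sg j) x).
Proof. by move=> h; rewrite /= h. Qed.

Lemma rot_shortcut (k : 'I_(size sg).+1) x : k != ord0 ->
  rot (inr (k, x)) = inl (place w (inr k.-1), turn true (nth true sg k.-1) x).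
Proof. by case: k => -[|j] lt //= _. Qed.

Lemma item_at_rank (k : 'I_(size sg).+1) : k != ord0 ->
  item_at (place w (inr k.-1)) = Some (inr k.-1).
Proof.
move=> k0; apply: item_at_place; rewrite w_rank.
by case: k k0 => -[|j] lt.
Qed.

Lemma rot_meet2 (i : 'I_(size w).+1) j x : item_at i = Some (inr j) ->
  rot (rot (inl (i, x))) = inl (i, ~~ x).
Proof.
move=> h; rewrite (rot_meet _ h).
have lt : (j.+1 < (size sg).+1)%N by rewrite ltnS -w_rank; apply: item_atP h.
rewrite rot_shortcut; last by apply/eqP => /(congr1 val); rewrite /= inordK.
rewrite inordK //= (place_item h); congr (inl (_, _)).
by rewrite /turn; case: (nth true sg j); case: x.
Qed.

Lemma rot_shortcut2 (k : 'I_(size sg).+1) x : k != ord0 ->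
  rot (rot (inr (k, x))) = inr (k, ~~ x).
Proof.
move=> k0; rewrite rot_shortcut // (rot_meet _ (item_at_rank k0)); congr (inr (_, _)).
  by apply: val_inj; case: k k0 => -[|j] lt //= _; rewrite inordK.
by rewrite /turn; case: (nth true sg _); case: x.
Qed.

Lemma rot_strand2 (i : 'I_(size w).+1) x : i != ord0 -> rot (rot (inl (i,
  x))) = inl (i, ~~ x).
Proof.
move=> i0; case h : (item_at i) => [[[c o]|j]|]; first exact: rot_crossing2 h.
  exact: rot_meet2 h.
by rewrite (item_at_None w_uniq h) eqxx in i0.
Qed.

(** Two rotations lead to the opposite half-edge, or back to the same one at an endpoint, so the
    cube of [rot] is its inverse. *)
Lemma rot_inj : injective rot.
Proof.
apply: (can_inj (g := fun d => rot (rot (rot d)))) => -[[i x]|[k x]].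
  have [->|i0] := eqVneq i ord0; first by [].
  by rewrite rot_strand2 // rot_strand2 // negbK.
have [->|k0] := eqVneq k ord0; first by [].
by rewrite rot_shortcut2 // rot_shortcut2 // negbK.
Qed.

Lemma edgeK : involutive edge.
Proof. by case=> d /=; rewrite strand_edgeK. Qed.

Lemma edge_neq d : edge d != d.
Proof.
case: d => d; apply/eqP => -[e]; have := strand_edge_neq d; by rewrite /= -{2}e eqxx.
Qed.

Lemma map_connected (h : shortcut_dart w sg -> rat) :
  h \o rot =1 h -> h \o edge =1 h -> forall d d', h d = h d'.
Proof.
move=> hr he.
have hl d : h (inl d) = h (inl (ord0, false)).
  apply: (strand_constant (h := fun d => h (inl d))) => [i x i0|d'].
    by rewrite -rot_strand2 //; exact: etrans (hr (rot (inl (i, x)))) (hr _).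
  exact: (he (inl d')).
have hs d : h (inr d) = h (inr (ord0, false)).
  apply: (strand_constant (h := fun d => h (inr d))) => [i x i0|d'].
    by rewrite -rot_shortcut2 //; exact: etrans (hr (rot (inr (i, x)))) (hr _).
  exact: (he (inr d')).
have e : h (inr (ord0, false)) = h (inl (ord0, false)) by exact: (hr (inl (ord0,
  false))).
have hc d : h d = h (inl (ord0, false)) by case: d => d; rewrite ?hl // hs.
by move=> d d'; rewrite !hc.
Qed.

Definition orientation (x : bool) : int := if x then -1 else 1.

(* The difference of the interval of the smoothing and of [K] itself, as a
   1-cycle. *)
Definition cycle_coef (d : dart w) : int :=
  (on d)%:Z - (on (strand_edge d))%:Z - orientation d.2.

Lemma on_smoothing d : on (sm d) = on (strand_edge d).
Proof.
rewrite -{1}[d](strand_edgeK d).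
exact: (on_me _ (@strand_edgeK _) (smoothingK s w_uniq w_mate)).
Qed.

Lemma on_start : on (ord0, false).
Proof. exact: connect0. Qed.

Lemma on_smoothing_neg d : on d -> ~~ on (sm d).
Proof.
exact: (on_m (@strand_edgeK _) (smoothingK s w_uniq w_mate) (@strand_edge_neq _)
  (smoothing_neq s w_mate)).
Qed.

Lemma on_finish : on (ord0, true) = false.
Proof. exact/negbTE/(on_smoothing_neg on_start). Qed.

Lemma cycle_coef_edge d : cycle_coef (strand_edge d) = - cycle_coef d.
Proof.
rewrite /cycle_coef strand_edgeK.
have -> : orientation (strand_edge d).2 = - orientation d.2 by case: d => i [].
by rewrite !opprB opprK addrC; lia.
Qed.

(** The interval and K have the same first and last half-edges. Consequently a function on faces
    with this coboundary has no jump around [v0] or [v1], and walks along K and along the shortcut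
    can be compared there. *)
Lemma cycle_coef_end x : cycle_coef (ord0, x) = 0.
Proof.
rewrite /cycle_coef -on_smoothing; case: x; last first.
  by rewrite on_start (_ : sm _ = (ord0, true)) // on_finish.
by rewrite on_finish (_ : sm _ = (ord0, false)) // on_start.
Qed.

Lemma cycle_coef_item (i : 'I_(size w).+1) j x : item_at i = Some (inr j) ->
  cycle_coef (i, x) = orientation x * ((on (i, false))%:Z - (on (i, true))%:Z - 1).
Proof.
move=> h; rewrite /cycle_coef -on_smoothing.
have -> : sm (i, x) = (i, ~~ x) by rewrite /smoothing /= h.
by case: x => /=; lia.
Qed.

Definition cycle_map (d : shortcut_dart w sg) : rat :=
  if d is inl d then (cycle_coef d)%:~R else 0.

Lemma invariant_smoothing (h : shortcut_dart w sg -> rat) (d : dart w) :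
  h \o rot =1 h -> d.1 != ord0 -> h (inl (sm d)) = h (inl d).
Proof.
case: d => i x hr /= i0; rewrite /smoothing /=.
case E : (item_at i) => [[[c o]|j]|].
- have hs (d : dart w) c' o' : item_at d.1 = Some (inl (c', o')) ->
      h (inl (strand_rot d)) = h (inl d).
    by case: d => i' x' h'; rewrite -[RHS](hr (inl (i', x'))) /= h'.
  have [e1 _] := point_of_rot w_mate (d := (i, x)) E.
  have [e2 _] := point_of_rot w_mate e1.
  case: ifP => _; first by rewrite (hs _ c o).
  by rewrite (hs _ _ _ e2) (hs _ _ _ e1) (hs _ c o).
- by rewrite -rot_strand2 //; exact: etrans (hr (rot (inl (i, x)))) (hr _).
- by rewrite (item_at_None w_uniq E) eqxx in i0.
Qed.

Lemma big_dart (F : dart w -> rat) :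
  \sum_d F d = \sum_i (F (i, false) + F (i, true)).
Proof.
rewrite (eq_bigr (fun d => F (d.1, d.2))); last by case.
rewrite -(pair_bigA _ (fun i x => F (i, x))) /=; apply: eq_bigr => i _.
by rewrite big_bool addrC.
Qed.

(** A [rot]-invariant function is a function on vertices, so this is Kirchhoff's law. It holds
    because the interval ([S1]) and K ([S2]) have the same boundary. *)
Lemma cycle_map_orthogonal (h : shortcut_dart w sg -> rat) :
  h \o rot =1 h -> \sum_d cycle_map d * h d = 0.
Proof.
move=> hr; rewrite big_sumType /= [X in _ + X]big1 ?addr0; last by move=> d _;
  rewrite mul0r.
pose h' d := h (inl d).
have S1 : \sum_d ((on d)%:Z%:~R - (on (sm d))%:Z%:~R) * h' d = h' (ord0,
  false) - h' (ord0, true).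
  under eq_bigr do rewrite mulrBl.
  rewrite sumrB [X in _ - X](reindex_inj (inv_inj (smoothingK s w_uniq w_mate))) /=
    -sumrB.
  under eq_bigr do rewrite (smoothingK s w_uniq w_mate) -mulrBr.
  rewrite big_dart (bigD1 ord0) //= big1 ?addr0.
    by rewrite on_start on_finish mul1r mul0r addr0.
  by move=> i i0; rewrite /h' !invariant_smoothing // !subrr !mulr0 addr0.
have S2 : \sum_(d : dart w) (orientation d.2)%:~R * h' d = h' (ord0,
  false) - h' (ord0, true).
  rewrite big_dart (bigD1 ord0) //= big1 ?addr0; first by rewrite mul1r mulN1r.
  move=> i i0; have -> : h' (i, true) = h' (i, false).
    by rewrite /h' -(rot_strand2 false) //;
      exact: etrans (hr (rot (inl (i, false)))) (hr _).
  by rewrite mul1r mulN1r subrr.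
rewrite (eq_bigr (fun d => ((on d)%:Z%:~R - (on (sm d))%:Z%:~R) * h' d
                          - (orientation d.2)%:~R * h' d)); last first.
  by move=> d _; rewrite -mulrBl /cycle_coef -on_smoothing !intrB.
by rewrite sumrB S1 S2 subrr.
Qed.

Definition crossing_height (d : dart w) : int :=
  if item_at d.1 is Some (inl p) then height p d.2 else 0.

Definition twin (i : 'I_(size w).+1) : 'I_(size w).+1 :=
  if item_at i is Some (inl (c, o)) then place w (inl (c, ~~ o)) else i.

Lemma twinK : involutive twin.
Proof.
move=> i; rewrite /twin; case h : (item_at i) => [[[c o]|j]|]; rewrite ?h //.
rewrite item_at_place; last by apply: w_mate; apply: item_atP h.
by rewrite negbK (place_item h).
Qed.

(* Let z = dy on the sphere.  Both sums are the difference of the values of y at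
   the two ends of K: on the left along the shortcut, on the right along the
   right-hand side of K. *)
Lemma face_jumps :
  \sum_(k : 'I_(size sg).+1 | k != ord0) cycle_map (rot (inr (k, true))) =
  \sum_(i : 'I_(size w).+1 | i != ord0) cycle_map (rot (inl (i, true))).
Proof.
have ze d : cycle_map (edge d) = - cycle_map d.
  by case: d => d /=; rewrite ?oppr0 // cycle_coef_edge intrN.
have [y y_face y_rot] := spherical_cycle rot_inj edgeK edge_neq map_connected
  w_spherical
  ze cycle_map_orthogonal.
have ye d : y (edge d) = y d + cycle_map d.
  by have := y_face (edge d); rewrite edgeK y_rot => <-; rewrite addrC subrK.
have yr d : y (rot d) = y d + cycle_map d by rewrite y_rot addrC subrK.
have T1 := @strand_telescope _ (fun d => y (inl d)) (fun d => cycle_map (inl d))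
  (fun i => cycle_map (rot (inl (i,
    true)))) (fun d => ye (inl d)) (fun d => ze (inl d)).
have T2 := @strand_telescope _ (fun d => y (inr d)) (fun d => cycle_map (inr d))
  (fun i => cycle_map (rot (inr (i,
    true)))) (fun d => ye (inr d)) (fun d => ze (inr d)).
have z0 x : cycle_map (inl (ord0, x)) = 0 by rewrite /= cycle_coef_end.
have y0 x : y (inr (ord0, x)) = y (inl (ord0, x)).
  by have := yr (inl (ord0, x)); rewrite z0 addr0.
have {}T1 : y (inl (ord0, true)) = y (inl (ord0, false)) +
    \sum_(i : 'I_(size w).+1 | i != ord0) cycle_map (rot (inl (i, true))).
  by rewrite -T1 ?z0 ?addr0 // => i i0; rewrite -yr -yr rot_strand2.
have {}T2 : y (inl (ord0, true)) = y (inl (ord0, false)) +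
    \sum_(k : 'I_(size sg).+1 | k != ord0) cycle_map (rot (inr (k, true))).
  by rewrite -!y0 -T2 ?addr0 // => k k0; rewrite -yr -yr rot_shortcut2.
by apply: (addrI (y (inl (ord0, false)))); rewrite -T1 -T2.
Qed.

(** Exchanges the order of the intersections along K for their order along the shortcut. *)
Lemma big_rank (V : nmodType) (F : nat -> 'I_(size w).+1 -> V) :
  \sum_i (if item_at i is Some (inr j) then F j i else 0) =
  \sum_(k : 'I_(size sg).+1 | k != ord0) F k.-1 (place w (inr k.-1)).
Proof.
pose P (i : 'I_(size w).+1) := if item_at i is Some (inr _) then true else false.
pose h' (i : 'I_(size w).+1) : 'I_(size sg).+1 :=
  if item_at i is Some (inr j) then inord j.+1 else ord0.
rewrite (bigID P) /= [X in _ + X]big1 ?addr0; last first.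
  by move=> i; rewrite /P; case: (item_at i) => [[]|].
rewrite (reindex_onto (fun k : 'I_(size sg).+1 => place w (inr k.-1)) h'); last first.
  move=> i; rewrite /P /h'; case E : (item_at i) => [[p|j]|] // _.
  have lt : (j.+1 < (size sg).+1)%N by rewrite ltnS -w_rank; apply: item_atP E.
  by rewrite inordK //= (place_item E).
apply: eq_big => [k|k].
  have [->|k0] := eqVneq k ord0; last first.
    rewrite /P /h' (item_at_rank k0) /=; apply/eqP/val_inj.
    by case: k k0 => -[|j] lt //= _; rewrite inordK.
  (* [k.-1] is 0 at [ord0] too. If [inr 0] occurs, [h'] returns 1 and excludes [ord0]; otherwise
     [inord] falls back on place 0, which bears no item. *)
  rewrite /P /h' /=; case: (boolP (inr 0%N \in w)) => [w0|nw0].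
    rewrite item_at_place // -val_eqE /= inordK //.
    by rewrite ltnS -w_rank.
  have -> : place w (inr 0%N) = ord0; last by [].
  apply: val_inj; rewrite /place /inord val_insubd.
  by rewrite ltnS index_mem (negPf nw0).
case/andP => + _; rewrite /P.
have [->|k0 _] := eqVneq k ord0; last by rewrite (item_at_rank k0).
case E : (item_at _) => [[p|j]|] // _; have := item_atP E => jw.
have := place_item E; case: (boolP (inr 0%N \in w)) => [w0|nw0] _.
  by move: E; rewrite item_at_place // => -[<-].
move: jw; rewrite w_rank => /(leq_ltn_trans (leq0n _)).
by rewrite -w_rank (negPf nw0).
Qed.

(** On its right, the shortcut has the incoming half-edge of K at a positive intersection and the
    outgoing one at a negative intersection. There I - K contributes the sign for K minus the one
    for I. *)
Lemma shortcut_jumps :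
  \sum_(k : 'I_(size sg).+1 | k != ord0) cycle_map (rot (inr (k, true))) =
  (\sum_(e <- sg) sign e - interval_number s w sg)%:~R.
Proof.
transitivity ((\sum_(i : 'I_(size w).+1) if item_at i is Some (inr j)
    then cycle_coef (i, nth true sg j) else 0)%:~R : rat).
  rewrite (big_rank (fun j i => cycle_coef (i, nth true sg j))) rmorph_sum.
  apply: eq_bigr => k k0; rewrite (rot_shortcut true k0) /=.
  by rewrite /turn; case: (nth true sg _).
congr (_%:~R).
have -> : \sum_(e <- sg) sign e = \sum_(i : 'I_(size w).+1)
    if item_at i is Some (inr j) then sign (nth true sg j) else 0.
  rewrite (big_rank (fun j _ => sign (nth true sg j))) (big_nth true) big_mkord.
  by rewrite [RHS]big_mkcond big_ord_recl /= add0r.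
rewrite /interval_number -sumrB; apply: eq_bigr => i _.
case h : (item_at i) => [[p|j]|]; rewrite ?subr0 //.
by rewrite (cycle_coef_item _ h) /sign /orientation; case: (nth true sg j); lia.
Qed.

Lemma item_at_twin (i : 'I_(size w).+1) c o :
  item_at i = Some (inl (c, o)) -> item_at (twin i) = Some (inl (c, ~~ o)).
Proof.
move=> h; rewrite /twin h item_at_place //; apply: w_mate; exact: item_atP h.
Qed.

Lemma dart_weight_height d : dart_weight s d = crossing_height d - crossing_height
  (sm d).
Proof.
have e := point_of_smoothing s w_mate d.
have e1 : item_at (sm d).1 = (mate (state_at s) (point_of d)).1 by rewrite -e.
have e2 : (sm d).2 = (mate (state_at s) (point_of d)).2 by rewrite -e.
rewrite /dart_weight /crossing_height e1 e2 /point_of.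
by case: (item_at d.1) => [[[c o]|j]|] /=; rewrite ?subr0.
Qed.

(** K has intersection number 0 with its push-off, since the two passes through a crossing
    contribute opposite signs. *)
Lemma crossing_height_orientation :
  \sum_(d : dart w) orientation d.2 * crossing_height d = 0.
Proof.
pose t (i : 'I_(size w).+1) : int :=
  if item_at i is Some (inl (c, o)) then (if o (+) c.2 then -1 else 1) else 0.
have -> : \sum_(d : dart w) orientation d.2 * crossing_height d = \sum_i t i.
  rewrite (eq_bigr (fun d => orientation d.2 * crossing_height (d.1, d.2)));
    last by case.
  rewrite -(pair_bigA _ (fun i x => orientation x * crossing_height (i, x))) /=.
  apply: eq_bigr => i _; rewrite big_bool /t /crossing_height /=.
  case: (item_at i) => [[[c o]|j]|] //.
  by rewrite /height /=; case: o; case: c.2.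
have : \sum_i t i = - \sum_i t i.
  rewrite {1}(reindex_inj (inv_inj twinK)) -sumrN; apply: eq_bigr => i _ /=.
  rewrite /t; case h : (item_at i) => [[[c o]|j]|].
  - by rewrite (item_at_twin h); case: o {h}; case: c.2.
  - by rewrite /twin h h oppr0.
  - by rewrite /twin h h oppr0.
lia.
Qed.

(** The half-edges lying to the right of K at crossings are those of height 1, so the jumps pair the
    cycle I - K with [crossing_height]. The part of K vanishes, and the part of I regroups into its
    turns, whose weights are differences of heights. *)
Lemma crossing_jumps :
  \sum_(i : 'I_(size w).+1 | i != ord0) cycle_map (rot (inl (i, true))) =
  (- \sum_(d | on d) dart_weight s (sm d))%:~R.
Proof.
transitivity ((\sum_(d : dart w) cycle_coef d * crossing_height d)%:~R : rat).
  rewrite (eq_bigr (fun d => cycle_coef (d.1, d.2) * crossing_height (d.1, d.2)));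
    last by case.
  rewrite -(pair_bigA _ (fun i x => cycle_coef (i, x) * crossing_height (i, x))).
  (* The half-edge to the right of one pass belongs to the other pass through the same crossing. *)
  rewrite [in RHS](reindex_inj (inv_inj twinK)) rmorph_sum big_mkcond.
  apply: eq_bigr => i _; rewrite big_bool /crossing_height [in RHS]/=.
  case h : (item_at i) => [[[c o]|j]|].
  - rewrite (item_at_twin h) ifT; last by apply/eqP => i0; rewrite i0 in h.
    rewrite (rot_crossing true h) /= /twin h /height /turn /=.
    by case: o {h}; case: c.2 => /=; rewrite ?mulr0 ?mulr1 ?add0r ?addr0.
  - rewrite /twin h h !mulr0 addr0 ifT; last by apply/eqP => i0; rewrite i0 in h.
    by rewrite (rot_meet true h).
  - by rewrite /twin h h !mulr0 addr0 (item_at_None w_uniq h) eqxx.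
congr (_%:~R); rewrite [in RHS]big_mkcond /=.
transitivity (\sum_(d : dart w) ((on d)%:Z - (on (sm d))%:Z) * crossing_height d).
  transitivity (\sum_(d : dart w) ((on d)%:Z - (on (sm d))%:Z) * crossing_height d
      - \sum_(d : dart w) orientation d.2 * crossing_height d); last first.
    by rewrite crossing_height_orientation subr0.
  rewrite -sumrB.
  by apply: eq_bigr => d _; rewrite -mulrBl /cycle_coef -on_smoothing.
rewrite (eq_bigr (fun d => (on d)%:Z * crossing_height d - (on (sm d))%:Z *
  crossing_height d));
  last by move=> d _; rewrite mulrBl.
rewrite sumrB [X in _ - X](reindex_inj (inv_inj (smoothingK s w_uniq w_mate))) /=
  -sumrB -sumrN.
apply: eq_bigr => d _; rewrite (smoothingK s w_uniq w_mate).
rewrite (dart_weight_smoothing s w_mate) dart_weight_height.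
by case: (on d); rewrite ?mul1r ?mul0r ?subrr ?opprK ?oppr0.
Qed.

(** The left-hand side is I . K' and the right-hand side is a(s) - a(K). *)
Lemma winding_number :
  \sum_(d | on d) dart_weight s (sm d) =
  interval_number s w sg - \sum_(e <- sg) sign e.
Proof.
have := face_jumps; rewrite shortcut_jumps crossing_jumps.
by move/intr_inj; lia.
Qed.

End Winding.

(** * The normalized bracket *)

Definition smooth_list (bs : seq bool) (cs : seq crossing) : seq (arc point) :=
  flatten [seq smooth_arcs bc.1 bc.2 | bc <- zip bs cs].

Lemma big_tuple_cons (V : nmodType) n (F : seq bool -> V) :
  \sum_(t : n.+1.-tuple bool) F t = \sum_(b : bool) \sum_(t : n.-tuple bool) F (b
    :: t).
Proof.
rewrite pair_bigA /= (reindex (fun bt : bool * n.-tuple bool =>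
  cons_tuple bt.1 bt.2)) //.
exists (fun t => (thead t, behead_tuple t)) => [[b t] _|t _].
  by congr (_, _); apply: val_inj.
by case/tupleP: t => b t; apply: val_inj.
Qed.

Lemma monomial_step (R : comUnitRingType) (A x : R) (b : bool) (n : int) :
  A \is a GRing.unit ->
  (if b then A else A^-1) * (A ^ n * x) = A ^ (sign b + n) * x.
Proof. by move=> uA; rewrite exprzDr // mulrA; case: b; rewrite ?expr1z ?exprN1. Qed.

Lemma skein_smooth_list cs L :
  skein cs L = \sum_(bs : (size cs).-tuple bool)
    varA ^ (\sum_(b <- bs) sign b) * value (smooth_list bs cs ++ L).
Proof.
elim: cs L => [|c cs IH] L.
  rewrite (big_pred1 [tuple]); last by move=> t; apply/esym/eqP; rewrite (tuple0 t).
  by rewrite big_nil expr0z mul1r.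
rewrite (@big_tuple_cons _ (size cs) (fun bs : seq bool =>
  varA ^ (\sum_(b <- bs) sign b) * value (smooth_list bs (c :: cs) ++ L))).
have step b : \sum_(t : (size cs).-tuple bool)
    varA ^ (\sum_(b' <- b :: t) sign b') * value (smooth_list (b :: t) (c :: cs) ++ L)
    = (if b then varA else varA^-1) * skein cs (smooth_arcs b c ++ L).
  rewrite IH mulr_sumr; apply: eq_bigr => t _; rewrite big_cons.
  apply: etrans (esym (monomial_step _ _ _ varA_unit)); congr (_ * _).
  apply/value_link/link_perm; rewrite -catA.
  exact: (permEl (perm_catCA (smooth_arcs b c) (smooth_list t cs) L)).
rewrite big_bool; apply: etrans (skein_cons c cs L) _.
by congr (_ + _); apply: esym; apply: step.
Qed.

Lemma skein_states (K : seq pass) L :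
  uniq (crossings K) ->
  skein (crossings K) L = \sum_(s : state K)
    varA ^ state_number s * value (smooth_all (state_at s) (crossings K) ++ L).
Proof.
move=> uK; rewrite skein_smooth_list.
pose f (s : state K) : (size (crossings K)).-tuple bool :=
  map_tuple (state_at s) (in_tuple (crossings K)).
pose g (t : (size (crossings K)).-tuple bool) : state K :=
  [ffun x : seq_sub (crossings K) => nth true t (index (val x) (crossings K))].
have fbij : bijective f.
  exists g.
    move=> s; apply/ffunP => x; rewrite ffunE /= (nth_map (val x)) ?index_mem
      ?(valP x) //.
    by rewrite nth_index ?(valP x) // /state_at valK.
  move=> t; apply: val_inj => /=; apply: (@eq_from_nth _ true).
    by rewrite size_map size_tuple.
  rewrite size_map => i lt; rewrite (nth_map (0%N, true)) //.
  by rewrite /state_at insubT ?mem_nth // => cK; rewrite ffunE /= index_uniq.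
rewrite (reindex f) /=; last exact: onW_bij.
apply: eq_bigr => s _.
have -> : smooth_list (f s) (crossings K) = smooth_all (state_at s) (crossings K).
  rewrite /smooth_list /smooth_all; congr flatten => /=.
  by elim: (crossings K) => //= c cs ->.
congr (_ ^ _ * _); rewrite big_map /state_number.
have pm : perm_eq (crossings K) (map val (enum {: seq_sub (crossings K)})).
  apply: uniq_perm => //; first by rewrite map_inj_uniq ?enum_uniq //; exact: val_inj.
  move=> c; apply/idP/mapP => [cK|[x _ ->]]; last exact: valP.
  by exists (SeqSub cK); rewrite ?mem_enum.
rewrite (perm_big _ pm) big_map big_enum /=; apply: eq_bigr => x _.
by rewrite /state_at valK.
Qed.

Section Diagram.

Variable Ka : shortcut_diagram.

Local Notation K := (code (base Ka)).
Local Notation w := (items Ka).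
Local Notation sg := (signs Ka).

Lemma code_uniq (D : diagram) : uniq (code D).
Proof. by have /andP [] := code_wf D. Qed.

Lemma mem_items_pass p : (inl p \in w) = (p \in K).
Proof.
rewrite -items_base mem_pmap; apply/idP/mapP => [pw|[[q|//] qw [->] //]].
by exists (inl p).
Qed.

Lemma mem_items_rank j : (inr j \in w) = (j < size sg)%N.
Proof. by rewrite -mem_ranks (perm_mem (items_signs Ka)) mem_iota add0n. Qed.

Lemma items_mate c o : inl (c, o) \in w -> inl (c, ~~ o) \in w.
Proof.
rewrite !mem_items_pass; have /andP [_ /allP h] := code_wf (base Ka).
exact: h.
Qed.

Lemma items_uniq : uniq w.
Proof.
have u1 : uniq (pmap pass_of w) by rewrite items_base code_uniq.
have u2 : uniq (pmap rank_of w) by rewrite (perm_uniq (items_signs Ka)) iota_uniq.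
elim: (w) u1 u2 => //= -[p|j] w' IH /=.
  move=> /andP [pw u1] u2; rewrite IH // andbT; apply: contra pw => pw.
  by rewrite mem_pmap; apply/mapP; exists (inl p).
move=> u1 /andP [jw u2]; rewrite IH // andbT; apply: contra jw => jw.
by rewrite mem_pmap; apply/mapP; exists (inr j).
Qed.

Lemma crossings_uniq : uniq (crossings K).
Proof.
rewrite /crossings map_inj_in_uniq ?filter_uniq ?code_uniq //.
by move=> [c o] [d o']; rewrite !mem_filter /= => /andP [-> _] /andP [-> _] ->.
Qed.

Lemma sum_signs : \sum_(e <- sg) sign e = (h_plus Ka)%:Z - (h_minus Ka)%:Z.
Proof.
rewrite /h_plus /h_minus; elim: (sg) => [|e s IH]; first by rewrite big_nil.
by rewrite big_cons IH; case: e => /=; lia.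
Qed.

Lemma value_state (s : state K) :
  value (smooth_all (state_at s) (crossings K) ++ strand start (map inl K) finish) =
  varu ^ (interval_number s w sg - ((h_plus Ka)%:Z - (h_minus Ka)%:Z)) * delta ^+
    loops s w.
Proof.
have ev := state_evaluates s items_uniq items_mate mem_items_pass.
rewrite (winding_number s items_uniq items_mate mem_items_rank (shortcut_spherical
  Ka)) in ev.
rewrite sum_signs in ev; rewrite -(valueE ev).
set R := smooth_all _ _.
have -> : value (R ++ strand start (map inl K) finish) =
          value (strand start (map inl (pmap pass_of w)) finish ++ R).
  by rewrite items_base; apply/value_link/link_perm; rewrite perm_catC.
rewrite -value_bivalent ?items_uniq //; last first.
  move=> j x _; rewrite mem_cat !inE negb_or /=.
  apply/negP => /mem_points [a /flatten_mapP [c _]].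
  by rewrite !inE => /orP [] /eqP ->.
apply/value_link/link_perm; rewrite perm_cat2l perm_catC //.
Qed.

Lemma interval_number_bound (s : state K) :
  `|interval_number s w sg| <= (h_plus Ka)%:Z + (h_minus Ka)%:Z.
Proof.
rewrite /interval_number (le_trans (ler_norm_sum _ _ _)) //.
apply: le_trans (_ : \sum_(i : 'I_(size w).+1) (if item_at i is Some (inr _) then 1
  else 0) <= _).
  apply: ler_sum => i _; case: (item_at i) => [[p|j]|] //.
  rewrite /sign; do 2!case: (on_interval _ _); case: (nth _ _ _) => //.
rewrite (big_rank items_uniq mem_items_rank (fun _ _ => 1)).
rewrite big_mkcond big_ord_recl /= add0r big_const_ord iter_addr_0.
have -> : (h_plus Ka)%:Z + (h_minus Ka)%:Z = (size sg)%:Z.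
  by rewrite -PoszD -(count_predC id).
by rewrite natz.
Qed.

Lemma shift_unit (R : comUnitRingType) (I : finType) (a u : R) (h : int) (x y : I
  -> R) (z : I -> int) :
  u \is a GRing.unit ->
  a * u ^ (- h) * (\sum_i x i * u ^ z i * y i) = a * \sum_i x i * (u ^ (z i - h) *
    y i).
Proof.
move=> uu; rewrite -mulrA mulr_sumr; congr (_ * _); apply: eq_bigr => i _.
by rewrite exprzDr //; ring.
Qed.

Lemma normalized_bracket_sum :
  normalized_bracket Ka = (- varA) ^ (- 3 * writhe K) * \sum_(s : state K)
    varA ^ state_number s *
    (varu ^ (interval_number s w sg - ((h_plus Ka)%:Z - (h_minus Ka)%:Z)) * delta
      ^+ loops s w).
Proof. exact: shift_unit varu_unit. Qed.

(** The right-hand side does not mention the shortcut, so independence of its choice and invariance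
    under the moves both follow from statements about codes. *)
Lemma normalized_bracket_code : normalized_bracket Ka = code_value K.
Proof.
rewrite normalized_bracket_sum /code_value (skein_states _ crossings_uniq).
apply: (congr1 (fun x => (- varA) ^ (- 3 * writhe K) * x)); apply: eq_bigr => s _.
exact: (congr1 (fun x => varA ^ state_number s * x) (esym (value_state s))).
Qed.

End Diagram.

(** * Exponents of u *)

Definition u_range (a b : int) (p : laurent) :=
  forall k, k \in msupp (p : {malg int[(int * int)%type]}) -> a <= k.2 <= b.

Lemma u_range_zero a b : u_range a b 0.
Proof. by move=> k; rewrite msupp0. Qed.

Lemma u_range_add a b p q : u_range a b p -> u_range a b q -> u_range a b (p + q).
Proof.
move=> hp hq k /(fsubsetP (msuppD_le _ _)); rewrite inE.
by case/orP => [/hp|/hq].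
Qed.

Lemma u_range_sum a b (I : finType) (F : I -> laurent) :
  (forall i, u_range a b (F i)) -> u_range a b (\sum_i F i).
Proof.
by move=> h; apply: (big_ind (u_range a b)) => //;
  [exact: u_range_zero | exact: u_range_add].
Qed.

Lemma u_range_mul a b c d p q :
  u_range a b p -> u_range c d q -> u_range (a + c) (b + d) (p * q).
Proof.
move=> hp hq; change (u_range (a + c) (b + d) (lmul p q)); rewrite /lmul.
rewrite big_seq; apply: (big_ind (u_range (a + c) (b + d)));
  [exact: u_range_zero | exact: u_range_add |].
move=> k1 k1p; rewrite big_seq; apply: (big_ind (u_range (a + c) (b + d)));
  [exact: u_range_zero | exact: u_range_add |].
move=> k2 k2p k /(fsubsetP msuppU_le); rewrite inE => /eqP ->.
have -> : (k1 + k2).2 = k1.2 + k2.2 by [].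
by have := hp _ k1p; have := hq _ k2p; lia.
Qed.

Lemma u_range_monomial (c : int) (k : int * int) : u_range k.2 k.2 << c *g k >>.
Proof. by move=> k' /(fsubsetP msuppU_le); rewrite inE => /eqP ->; rewrite lexx. Qed.


Lemma u_range_opp a b p : u_range a b p -> u_range a b (- p).
Proof. by move=> h k; rewrite msuppN; apply: h. Qed.

Lemma u_range_one : u_range 0 0 1.
Proof. exact: (@u_range_monomial 1 (0, 0)). Qed.

Lemma u_range_expn a p n : u_range a a p -> u_range (a *+ n) (a *+ n) (p ^+ n).
Proof.
move=> h; elim: n => [|n IH]; first exact: u_range_one.
by rewrite exprS !mulrS; apply: u_range_mul.
Qed.

Lemma exprz_inverse (R : comUnitRingType) (p q : R) (n : nat) :
  q * p = 1 -> p ^ Negz n = q ^+ n.+1.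
Proof. by move=> qp; rewrite NegzE -exprnN -exprVn (mulr1_eq (y := q)) // mulrC. Qed.

(** For negative powers an explicit inverse [q] is supplied, because the inverse in the ring is
    obtained by choice and does not show its support. *)
Lemma u_range_expz (p q : laurent) a (n : int) :
  q * p = 1 -> u_range a a p -> u_range (- a) (- a) q ->
    u_range (a * n) (a * n) (p ^ n).
Proof.
move=> qp hp hq; case: n => n.
  have -> : a * n = a *+ n by rewrite -natz mulr_natr.
  exact: u_range_expn.
have -> : a * Negz n = (- a) *+ n.+1 by rewrite NegzE mulrN -mulNr -natz mulr_natr.
rewrite (exprz_inverse n qp); exact: u_range_expn.
Qed.

Lemma varA_inv : (<< 1 *g (- 1, 0) >> : laurent) * varA = 1.
Proof. exact: lmulUU. Qed.

Lemma varu_inv : (<< 1 *g (0, - 1) >> : laurent) * varu = 1.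
Proof. exact: lmulUU. Qed.

Lemma u_range_varA n : u_range 0 0 (varA ^ n).
Proof.
have := @u_range_expz _ _ 0 n varA_inv (@u_range_monomial 1 (1,
  0)) (@u_range_monomial 1 (- 1, 0)).
by rewrite mul0r.
Qed.

Lemma u_range_oppA n : u_range 0 0 ((- varA) ^ n).
Proof.
have inv : - (<< 1 *g (- 1, 0) >> : laurent) * - varA = 1 by rewrite mulrNN varA_inv.
have := @u_range_expz _ _ 0 n inv (u_range_opp (@u_range_monomial 1 (1, 0)))
  (u_range_opp (@u_range_monomial 1 (- 1, 0))).
by rewrite mul0r.
Qed.

Lemma u_range_varu n : u_range n n (varu ^ n).
Proof.
have := @u_range_expz _ _ 1 n varu_inv (@u_range_monomial 1 (0,
  1)) (@u_range_monomial 1 (0, - 1)).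
by rewrite mul1r.
Qed.

Lemma u_range_delta : u_range 0 0 delta.
Proof.
by apply: u_range_add; apply: u_range_opp; apply: u_range_varA.
Qed.

Lemma u_range_weaken a b c d p : c <= a -> b <= d -> u_range a b p -> u_range c d p.
Proof. by move=> ca bd h k /h; lia. Qed.

Lemma normalized_bracket_range Ka :
  u_range (- (2 * h_plus Ka)%N%:Z) (2 * h_minus Ka)%N%:Z (normalized_bracket Ka).
Proof.
rewrite normalized_bracket_sum -[X in u_range X]add0r -[X in u_range _ X]add0r.
apply: u_range_mul; first exact: u_range_oppA.
apply: u_range_sum => s.
set z := interval_number _ _ _ - _.
have [lo hi] : (- (2 * h_plus Ka)%N%:Z <= z) /\ (z <= (2 * h_minus Ka)%N%:Z).
  by have := interval_number_bound s; rewrite /z; lia.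
apply: (u_range_weaken lo hi); rewrite -[X in u_range X]add0r -[X in u_range _
  X]add0r.
apply: u_range_mul; first exact: u_range_varA.
rewrite -[X in u_range X]addr0 -[X in u_range _ X]addr0.
apply: u_range_mul; first exact: u_range_varu.
have := u_range_expn (n := loops s (items Ka)) u_range_delta.
by rewrite mul0rn.
Qed.

Lemma deg_u_minus_le a b p : a <= 0 -> u_range a b p -> deg_u_minus p <= - a.
Proof.
move=> a0 h; rewrite /deg_u_minus big_seq;
  apply: (big_ind (fun x => x <= - a)) => [|x y|k /h].
- by rewrite oppr_ge0.
- by rewrite ge_max => -> ->.
- by case/andP; rewrite lerN2.
Qed.

Lemma deg_u_plus_le a b p : 0 <= b -> u_range a b p -> deg_u_plus p <= b.
Proof.
move=> b0 h; rewrite /deg_u_plus big_seq;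
  apply: (big_ind (fun x => x <= b)) => [|x y|k /h].
- by [].
- by rewrite ge_max => -> ->.
- by case/andP.
Qed.

Lemma min_setP (A : set nat) h : A h -> A (min_set A).
Proof.
move=> Ah; rewrite /min_set; case: xgetP => [m _ [] //|].
suff [m Am] : exists m, A m /\ forall h', A h' -> (m <= h')%N by move=> /(_ m).
have [n] := ubnP h; elim: n h Ah => // n IH h Ah hn.
case: (pselect (exists h', A h' /\ (h' < h)%N)) => [[h' [Ah' lt]]|no].
  by apply: IH Ah' _; apply: leq_trans lt _.
exists h; split=> // h' Ah'; rewrite leqNgt; apply/negP => lt.
by apply: no; exists h'.
Qed.

Lemma represents_bracket (k : knotoid) Ka Kb :
  represents Ka k -> represents Kb k -> normalized_bracket Ka = normalized_bracket Kb.
Proof.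
have [K0 kE] := knotoid_class k; rewrite /represents !kE => ea eb.
rewrite !normalized_bracket_code.
exact (etrans (esym (equivalent_value ea)) (equivalent_value eb)).
Qed.

Lemma turaevE (k : knotoid) Ka : represents Ka k -> turaev k = normalized_bracket Ka.
Proof.
move=> ka; rewrite /turaev; case: xgetP => [p _ [Kb kb e]|no].
  exact (etrans (esym e) (represents_bracket kb ka)).
case: (no (normalized_bracket Ka)).
exact (ex_intro2 _ _ Ka ka (erefl _)).
Qed.

Theorem theorem1p6 (k : knotoid) :
  ((2 * height_plus k)%N%:Z >= deg_u_minus (turaev k)) /\
  ((2 * height_minus k)%N%:Z >= deg_u_plus (turaev k)).
Proof.
(* Without a shortcut diagram the polynomial is 0 by the default in its definition, and both degrees
   are 0. *)
case: (pselect (exists Ka, represents Ka k)) => [[Ka ka]|no]; last first.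
  have -> : turaev k = 0.
    rewrite /turaev; case: xgetP => // p _ [Ka ka _].
    by case: no; exists Ka.
  split; first by apply: le_trans (deg_u_minus_le (lexx 0) (@u_range_zero 0 0)) _;
    rewrite oppr0.
  exact: le_trans (deg_u_plus_le (lexx 0) (@u_range_zero 0 0)) _.
split.
(* The two minima may be attained by different shortcut diagrams; the bracket of either one is
   [turaev k]. *)
- have [Kb kb <-] : (exists2 Kb, represents Kb k & h_plus Kb = height_plus k).
    exact: (@min_setP (fun h => exists2 Kb, represents Kb k & h_plus Kb = h) _
              (ex_intro2 _ _ Ka ka erefl)).
  have le0 : - (2 * h_plus Kb)%N%:Z <= 0 :> int by lia.
  by have := deg_u_minus_le le0 (@normalized_bracket_range Kb);
    rewrite opprK (turaevE kb).
- have [Kb kb <-] : (exists2 Kb, represents Kb k & h_minus Kb = height_minus k).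
    exact: (@min_setP (fun h => exists2 Kb, represents Kb k & h_minus Kb = h) _
              (ex_intro2 _ _ Ka ka erefl)).
  have le0 : 0 <= (2 * h_minus Kb)%N%:Z :> int by lia.
  by have := deg_u_plus_le le0 (@normalized_bracket_range Kb); rewrite (turaevE kb).
Qed.
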